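(* Consider the static feedback optimization problem with the single objective $J(\cdot,\cdot;t_0)$, $t_0$ fixed, and suppose that: (1) $f(\cdot;t_0)$ and $g(\cdot;t_0)$ are twice continuously differentiable and $p$-strongly convex; (2) $\mathcal{X}=\mathcal{X}_1\times\dots\times\mathcal{X}_N$ with each $\mathcal{X}_i\subseteq\mathbb{R}^{n_i}$ non-empty, compact and polyhedral; (3) partial asynchrony holds with constant $B\in\mathbb{N}$. Let $N$ agents execute the asynchronous feedback optimization algorithm with stepsize $\gamma_0\in(0,\gamma_{\max,0})$, generating the true network state $\{x(k),y(k)\}_{k\in\mathbb{N}_0}$. Then for any $r_0\in\mathbb{N}$, $$\alpha(r_0B;t_0)\le a_0\,\rho_0^{\,r_0-1},\qquad \beta(r_0B)\le b_0\,\rho_0^{\,r_0-1},\qquad \delta(r_0B)\le d_0\,\rho_0^{\,r_0-1},$$ where $$a_0=\max\Big\{L_{J,0}(1+\|C\|)\,\mathrm{diam}(\mathcal{X}),\ \frac{8E_0\big(\frac{G_0}{F_0}+\frac{E_0}{D_0}\big)F_0}{D_0}\,B\,\mathrm{diam}(\mathcal{X})^2\Big\},\qquad b_0=\frac{D_0}{8E_0\big(\frac{G_0}{F_0}+\frac{E_0}{D_0}\big)F_0}\,a_0,$$ $d_0=B^2m\|C\|^2b_0$, and $D_0,E_0,F_0,G_0,c_0,\rho_0=1-\gamma_0c_0\in(0,1),\gamma_{\max,0}$ are the explicit constants given in the context.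
   Context: **Problem.** $\mathbb{N}=\{1,2,\dots\}$, $\mathbb{N}_0=\mathbb{N}\cup\{0\}$, $[N]=\{1,\dots,N\}$; $\|\cdot\|$ is the Euclidean norm (and induced matrix norm); $\mathrm{diam}(\mathcal{X})=\sup_{x,y\in\mathcal{X}}\|x-y\|$; $\Pi_Z$ is Euclidean projection onto the closed convex set $Z$. There are $N$ agents; $n=\sum_i n_i$, $m=\sum_i m_i$; $C\in\mathbb{R}^{m\times n}$ has column blocks $C=[C_1\ \cdots\ C_N]$, $C_i\in\mathbb{R}^{m\times n_i}$, and row blocks $C_{i*}\in\mathbb{R}^{m_i\times n}$. $\mathcal{Y}=\{Cx:x\in\mathcal{X}\}$. For $f:\mathbb{R}^n\times\mathbb{N}_0\to\mathbb{R}$, $g:\mathbb{R}^m\times\mathbb{N}_0\to\mathbb{R}$, put $J(x,y;t)=f(x;t)+g(y;t)$; the gradient with respect to inputs is $\nabla_xJ(x,y;t)=\nabla_xf(x;t)+C^T\nabla_yg(y;t)$, with block $\nabla_{x_i}J(x,y;t)=\nabla_{x_i}f(x;t)+C_i^T\nabla_yg(y;t)$. Here $x^*(t_0)=\arg\min_{x\in\mathcal{X}}f(x;t_0)+g(Cx;t_0)$ and $y^*(t_0)=Cx^*(t_0)$. **Algorithm.** Agent $i$ stores $x^i(k)=(x^i_1(k),\dots,x^i_N(k))$ and $y^i(k)=(y^i_1(k),\dots,y^i_N(k))$, $x^i_j(k)\in\mathbb{R}^{n_j}$, $y^i_j(k)\in\mathbb{R}^{m_j}$. The true state is $x(k)=(x^1_1(k),\dots,x^N_N(k))$,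 $y(k)=Cx(k)$, $y_i(k)=C_{i*}x(k)$; initially $x^i_i(0)\in\mathcal{X}_i$. Let $\mathcal{K}^i$ (resp. $\mathcal{M}^i$) be the set of times at which agent $i$ computes (resp. measures) and $\mathcal{C}^j_i$ the set of times at which $i$ receives a transmission from $j$. Here $\tau^i_j(k)$ is the time at which agent $j$ originally computed the value $x^i_j(k)$, and $\mu^i_j(k)$ is the time at which agent $j$ originally measured the value $y^i_j(k)$, so $x^i_j(k)=x^j_j(\tau^i_j(k))$ for $j\ne i$ and $y^i_j(k)=C_{j*}x(\mu^i_j(k))$. Updates for all $k\ge0$: $x^i_i(k+1)=\Pi_{\mathcal{X}_i}\big[x^i_i(k)-\gamma_0\big(\nabla_{x_i}f(x^i(k);t_0)+C_i^T\nabla_yg(y^i(k);t_0)\big)\big]$ if $k\in\mathcal{K}^i$, else $x^i_i(k+1)=x^i_i(k)$; $y^i_i(k+1)=y_i(k)$ if $k\in\mathcal{M}^i$, else $y^i_i(k+1)=y^i_i(k)$; for $j\neq i$, $x^i_j$ and $y^i_j$ are replaced by the received (possibly old) values of $x^j_j$ and of agent $j$'s measured output (those of times $\tau^i_j(k)$, $\mu^i_j(k)$) if $k\in\mathcal{C}^j_i$, and are unchanged otherwise. **Partial asynchrony** with $B\in\mathbb{N}$: for every $i$ and $k\ge0$, each of $\mathcal{K}^i$ and $\mathcal{M}^i$ contains at least one element of $\{k,\dots,k+B-1\}$; and $\max\{0,k-B+1\}\le\tau^i_j(k)\le k$, $\max\{0,k-B+1\}\le\mu^i_j(k)\le k$ for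 all $i,j\in[N]$, $k\ge0$. **Error quantities.** $s_i(k)=x^i_i(k+1)-x^i_i(k)$ if $k\in\mathcal{K}^i$, else $0$; $q_i(k)=y^i_i(k+1)-y^i_i(k)$ if $k\in\mathcal{M}^i$, else $0$; $s=(s_1,\dots,s_N)$, $q=(q_1,\dots,q_N)$; $s(\tau)=0$, $q(\tau)=0$ for $\tau<0$. $\alpha(k;t_0)=J(x(k),y(k);t_0)-J(x^*(t_0),y^*(t_0);t_0)$, $\beta(k)=\sum_{\tau=k-B}^{k-1}\|s(\tau)\|^2$, $\delta(k)=\sum_{\tau=k-B}^{k-1}\|q(\tau)\|^2$. **Constants** (index $\ell=0$). $L_{x,\ell},L_{y,\ell}>0$: upper bounds on $\|\nabla_x^2f(\cdot;t_\ell)\|$ over $\mathcal{X}$ and $\|\nabla_y^2g(\cdot;t_\ell)\|$ over $\mathcal{Y}$ (Lipschitz constants of $\nabla_xf$, $\nabla_yg$). $L_{J,\ell}>0$, $L_\ell>0$: Lipschitz constants of $J(\cdot,\cdot;t_\ell)$ and $\nabla_xJ(\cdot,\cdot;t_\ell)$ on $\mathcal{X}\times\mathcal{Y}$. $\lambda>0$: error-bound constant, i.e. $\|x-x^*(t_\ell)\|\le\lambda\max\{1,\gamma^{-1}\}\|x-\Pi_{\mathcal{X}}[x-\gamma\nabla_xJ(x,Cx;t_\ell)]\|$ for all $x\in\mathcal{X}$, $\gamma>0$. Writing $L=L_\ell$, $L_x=L_{x,\ell}$, $L_y=L_{y,\ell}$: $$D_\ell=\tfrac12\big(2-\gamma_\ell((1+B)L_x+(1+BN)\|C\|^2L_y)\big),\qquad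 E_\ell=\tfrac12NB(L_x+L_yN\|C\|^2),$$ $$F_\ell=\tfrac12\Big((1+\lambda^2)\big[36B^3\|C\|^6L^2L_y^2N^2m+72B^3\|C\|^4L^2L_xL_yN^2m+36BL^2L_x^2N^2+36B^3\|C\|^2L^2L_x^2N^2m+36B\|C\|^4L^2L_y^2N^2+18\|C\|^2L_xL_yN+72B\|C\|^2L^2L_xL_yN^2+9\|C\|^4L_y^2N\big]+3B^2\|C\|^6L^2L_y^2N^2m+\|C\|^4\big[72B^3L^2L_yN^2m+6B^2L^2L_xL_yN^2m+6B^2L^2L_yN^2m+3L^2L_y^2N^2+3B^2L_y^2Nm\big]+\|C\|^2\big[96B^3L^2N^2m+72B^3L^2L_xN^2m+72BL^2L_yN^2+60B^3L^2N^2\lambda^2m+18L_yN+8B^2L^2N^2m+6B^2L^2L_xN^2m+6L^2L_xL_yN^2+6L^2L_yN^2+3B^2L^2L_x^2N^2m\big]+3L^2L_x^2N^2+96BL^2N^2+6L^2L_xN^2+8L^2N^2+60BL^2N^2\lambda^2+72BL^2L_xN^2+12L_x^2N+9L_x^2N\lambda^2+18L_xN+15N\lambda^2+24N+2\Big),$$ $$G_\ell=\tfrac N2\Big((1+\lambda^2)\big[72B^3\|C\|^4L^2L_xL_yNm+72B\|C\|^2L^2L_xL_yN+36B^3\|C\|^6L^2L_y^2Nm+36B^3\|C\|^2L^2L_x^2Nm+36B\|C\|^4L^2L_y^2N+36BL^2L_x^2N\big]+3B^2\|C\|^6L^2L_y^2Nm+\|C\|^4\big[72B^3L^2L_yNm+6B^2L^2L_xL_yNm+6B^2L^2L_yNm+3B^2L_y^2m+3L^2L_y^2N\big]+\|C\|^2\big[96B^3L^2Nm+72B^3L^2L_xNm+72BL^2L_yN+60B^3L^2N\lambda^2m+8B^2L^2Nm+6B^2L^2L_xNm+6L^2L_xL_yN+6L^2L_yN+3B^2L^2L_x^2Nm+BL_yN\big]+96BL^2N+72BL^2L_xN+60BL^2N\lambda^2+8L^2N+6L^2L_xN+3L_x^2+3L^2L_x^2N+BL_x\Big),$$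 $$c_\ell=\frac{D_\ell}{2F_\ell+2D_\ell}\in(0,\tfrac12),\qquad\rho_\ell=1-\gamma_\ell c_\ell\in(0,1),$$ $$\gamma_{\max,\ell}=\min\Big\{\tfrac{2}{(3N+1)BL_x+(3N^2+1)B\|C\|^2L_y},\ \tfrac{2}{(1+B)L_x+(1+BN)\|C\|^2L_y},\ \tfrac{D_\ell}{E_\ell},\ \big(\tfrac{G_\ell}{F_\ell}+\tfrac{E_\ell}{D_\ell}\big)^{-1},\ \tfrac1{2c_\ell},\ \tfrac{D_\ell}{8F_\ell(\frac{G_\ell}{F_\ell}+\frac{E_\ell}{D_\ell})c_\ell},\ \tfrac{\frac{a_\ell}{b_\ell}+2E_\ell+D_\ell c_\ell-\sqrt{(\frac{a_\ell}{b_\ell}+2E_\ell+D_\ell c_\ell)^2-4D_\ell E_\ell c_\ell}}{2E_\ell c_\ell},\ \tfrac12\Big\}.$$ Some of these constants depend on $\gamma_\ell$; the condition $\gamma_\ell\in(0,\gamma_{\max,\ell})$ means that $\gamma_\ell>0$ is strictly less than each term of the minimum, with the terms evaluated at that $\gamma_\ell$ (in particular $D_\ell>0$).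
   Formalization: L_y is also assumed to be a Lipschitz constant of ∇_y g on all vectors whose blocks are outputs C_{j*}x of possibly different x in X (what agents may store), not only a Hessian bound over Y; with Y alone the claim fails. *)

(* Defs.v *)
From HB Require Import structures.
From mathcomp Require Import all_boot all_order all_algebra.
From mathcomp Require Import all_classical all_reals all_analysis.

Set Implicit Arguments.
Unset Strict Implicit.
Unset Printing Implicit Defensive.

Import Order.TTheory GRing.Theory Num.Theory.
Import numFieldNormedType.Exports.

Local Open Scope classical_set_scope.
Local Open Scope ring_scope.

Section EuclideanSpace.
Variable R : realType.

(* The library norm `|v| on matrices is the sup norm. *)
Definition enorm n (v : 'cV[R]_n) : R := Num.sqrt (\sum_i v i 0 ^+ 2).

Definition opnorm m n (A : 'M[R]_(m, n)) : R :=
  sup [set enorm (A *m v) | v in [set v : 'cV[R]_n | enorm v <= 1]].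

Definition diameter n (X : set 'cV[R]_n) : R :=
  sup [set enorm (z.1 - z.2) | z in X `*` X].

(* Well defined on nonempty closed convex sets. *)
Definition euclid_proj n (Z : set 'cV[R]_n) (v : 'cV[R]_n) : 'cV[R]_n :=
  get [set z | Z z /\ forall w, Z w -> enorm (v - z) <= enorm (v - w)].

Definition argmin n (Z : set 'cV[R]_n) (F : 'cV[R]_n -> R) : 'cV[R]_n :=
  get [set z | Z z /\ forall w, Z w -> F z <= F w].

Definition polyhedral n (Z : set 'cV[R]_n) : Prop :=
  exists (q : nat) (A : 'M[R]_(q, n)) (b : 'cV[R]_q),
    Z = [set z | forall i, (A *m z) i 0 <= b i 0].

Definition strongly_convex n (p : R) (F : 'cV[R]_n -> R) : Prop :=
  forall (x y : 'cV[R]_n) (t : R), 0 <= t <= 1 ->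
    F (t *: x + (1 - t) *: y) <=
    t * F x + (1 - t) * F y - p / 2 * t * (1 - t) * enorm (x - y) ^+ 2.

Definition grad n (F : 'cV[R]_n -> R) (x : 'cV[R]_n) : 'cV[R]_n :=
  \col_i 'D_(delta_mx i 0) F x.

Definition hess n (F : 'cV[R]_n -> R) (x : 'cV[R]_n) : 'M[R]_n :=
  \matrix_(i, j) 'D_(delta_mx j 0) (fun z => grad F z i 0) x.

Definition twice_continuously_differentiable n (F : 'cV[R]_n -> R) : Prop :=
  [/\ forall x, differentiable F x,
      forall x, differentiable (grad F) x
    & continuous (hess F)].

End EuclideanSpace.

Section Algorithm.
Variables (R : realType) (N : nat) (n_ m_ : 'I_N -> nat).
Local Notation n := (\sum_i n_ i)%N.
Local Notation m := (\sum_i m_ i)%N.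

Definition block_prod (X_ : forall i, set 'cV[R]_(n_ i)) : set 'cV[R]_n :=
  [set x | forall i, X_ i (submxcol x i)].

Variable C : 'M[R]_(m, n).

Definition output_set (X : set 'cV[R]_n) : set 'cV[R]_m :=
  [set C *m x | x in X].

(* The output vectors held by the agents: the blocks of such a vector are
   outputs measured at different times, so that it may lie outside
   output_set X. *)
Definition mixed_output_set (X : set 'cV[R]_n) : set 'cV[R]_m :=
  [set y | forall j, exists2 x, X x & submxcol y j = submxcol C j *m x].

(* F and G stand for f(.; t) and g(.; t) at a fixed time t. *)
Variables (F : 'cV[R]_n -> R) (G : 'cV[R]_m -> R).

Definition objective (x : 'cV[R]_n) (y : 'cV[R]_m) : R := F x + G y.

Definition gradx (x : 'cV[R]_n) (y : 'cV[R]_m) : 'cV[R]_n :=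
  grad F x + C^T *m grad G y.

Definition gradx_block (i : 'I_N) (x : 'cV[R]_n) (y : 'cV[R]_m)
    : 'cV[R]_(n_ i) :=
  submxcol (grad F x) i + (submxrow C i)^T *m grad G y.

Definition minimizer (X : set 'cV[R]_n) : 'cV[R]_n :=
  argmin X (fun x => objective x (C *m x)).

(* recv_times i j is the set of times at which i receives a transmission from j;
   xstamp i j k (resp. ystamp i j k) is the time at which j originally computed
   (resp. measured) the block j held by i at time k. *)
Record schedule := Schedule {
  compute_times : 'I_N -> set nat;
  measure_times : 'I_N -> set nat;
  recv_times : 'I_N -> 'I_N -> set nat;
  xstamp : 'I_N -> 'I_N -> nat -> nat;
  ystamp : 'I_N -> 'I_N -> nat -> nat }.

(* k.+1 - B is max {0, k - B + 1}, subtraction on nat being truncated. *)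
Definition partially_asynchronous (B : nat) (S : schedule) : Prop :=
  [/\ forall i k, exists2 l, compute_times S i l & (k <= l < k + B)%N,
      forall i k, exists2 l, measure_times S i l & (k <= l < k + B)%N,
      forall i j k, (k.+1 - B <= xstamp S i j k <= k)%N
    & forall i j k, (k.+1 - B <= ystamp S i j k <= k)%N].

(* xblk i j k (resp. yblk i j k) is the block j of the input (resp. output)
   vector stored by agent i at time k. *)
Record trajectory := Trajectory {
  xblk : forall i j : 'I_N, nat -> 'cV[R]_(n_ j);
  yblk : forall i j : 'I_N, nat -> 'cV[R]_(m_ j) }.

Variables (S : schedule) (T : trajectory).

Definition xagent (i : 'I_N) (k : nat) : 'cV[R]_n := \mxcol_j xblk T i j k.
Definition yagent (i : 'I_N) (k : nat) : 'cV[R]_m := \mxcol_j yblk T i j k.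

Definition xtrue (k : nat) : 'cV[R]_n := \mxcol_i xblk T i i k.
Definition ytrue (k : nat) : 'cV[R]_m := C *m xtrue k.

Record executes (X_ : forall i, set 'cV[R]_(n_ i)) (gamma : R) : Prop := {
  exec_init : forall i, X_ i (xblk T i i 0%N);
  exec_compute : forall i k,
    xblk T i i k.+1 =
      if k \in compute_times S i then
        euclid_proj (X_ i) (xblk T i i k
                     - gamma *: gradx_block i (xagent i k) (yagent i k))
      else xblk T i i k;
  exec_measure : forall i k,
    yblk T i i k.+1 =
      if k \in measure_times S i then submxcol (ytrue k) i else yblk T i i k;
  exec_xrecv : forall i j k, j != i ->
    xblk T i j k.+1 =
      if k \in recv_times S i j then xblk T j j (xstamp S i j k.+1)
      else xblk T i j k;
  exec_yrecv : forall i j k, j != i ->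
    yblk T i j k.+1 =
      if k \in recv_times S i j then submxcol C j *m xtrue (ystamp S i j k.+1)
      else yblk T i j k;
  exec_xstamp : forall i j k, j != i ->
    xblk T i j k = xblk T j j (xstamp S i j k);
  exec_ystamp : forall i j k,
    yblk T i j k = submxcol C j *m xtrue (ystamp S i j k) }.

Definition xstep (k : nat) : 'cV[R]_n :=
  \mxcol_i (if k \in compute_times S i then xblk T i i k.+1 - xblk T i i k else 0).

Definition ystep (k : nat) : 'cV[R]_m :=
  \mxcol_i (if k \in measure_times S i then yblk T i i k.+1 - yblk T i i k else 0).

Definition alpha_err (X : set 'cV[R]_n) (k : nat) : R :=
  objective (xtrue k) (ytrue k)
  - objective (minimizer X) (C *m minimizer X).

(* The truncated lower bound k - B drops the terms with negative index, which
   are zero by convention. *)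
Definition beta_err (B k : nat) : R :=
  \sum_(k - B <= tau < k) enorm (xstep tau) ^+ 2.

Definition delta_err (B k : nat) : R :=
  \sum_(k - B <= tau < k) enorm (ystep tau) ^+ 2.

End Algorithm.

Section Constants.
(* nC is the norm of C, diamX the diameter of X; N, B and the number m of
   outputs are given as real numbers. *)
Variables (R : realType) (N B m nC L LJ Lx Ly lam diamX gamma : R).

Definition Dc : R :=
  2^-1 * (2 - gamma * ((1 + B) * Lx + (1 + B * N) * nC ^+ 2 * Ly)).

Definition Ec : R := 2^-1 * N * B * (Lx + Ly * N * nC ^+ 2).

Definition Fc : R := 2^-1 *
  ((1 + lam ^+ 2) *
     (36 * B ^+ 3 * nC ^+ 6 * L ^+ 2 * Ly ^+ 2 * N ^+ 2 * m
      + 72 * B ^+ 3 * nC ^+ 4 * L ^+ 2 * Lx * Ly * N ^+ 2 * m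
      + 36 * B * L ^+ 2 * Lx ^+ 2 * N ^+ 2
      + 36 * B ^+ 3 * nC ^+ 2 * L ^+ 2 * Lx ^+ 2 * N ^+ 2 * m
      + 36 * B * nC ^+ 4 * L ^+ 2 * Ly ^+ 2 * N ^+ 2
      + 18 * nC ^+ 2 * Lx * Ly * N
      + 72 * B * nC ^+ 2 * L ^+ 2 * Lx * Ly * N ^+ 2
      + 9 * nC ^+ 4 * Ly ^+ 2 * N)
   + 3 * B ^+ 2 * nC ^+ 6 * L ^+ 2 * Ly ^+ 2 * N ^+ 2 * m
   + nC ^+ 4 *
     (72 * B ^+ 3 * L ^+ 2 * Ly * N ^+ 2 * m
      + 6 * B ^+ 2 * L ^+ 2 * Lx * Ly * N ^+ 2 * m
      + 6 * B ^+ 2 * L ^+ 2 * Ly * N ^+ 2 * m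
      + 3 * L ^+ 2 * Ly ^+ 2 * N ^+ 2
      + 3 * B ^+ 2 * Ly ^+ 2 * N * m)
   + nC ^+ 2 *
     (96 * B ^+ 3 * L ^+ 2 * N ^+ 2 * m
      + 72 * B ^+ 3 * L ^+ 2 * Lx * N ^+ 2 * m
      + 72 * B * L ^+ 2 * Ly * N ^+ 2
      + 60 * B ^+ 3 * L ^+ 2 * N ^+ 2 * lam ^+ 2 * m
      + 18 * Ly * N
      + 8 * B ^+ 2 * L ^+ 2 * N ^+ 2 * m
      + 6 * B ^+ 2 * L ^+ 2 * Lx * N ^+ 2 * m
      + 6 * L ^+ 2 * Lx * Ly * N ^+ 2
      + 6 * L ^+ 2 * Ly * N ^+ 2
      + 3 * B ^+ 2 * L ^+ 2 * Lx ^+ 2 * N ^+ 2 * m)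
   + 3 * L ^+ 2 * Lx ^+ 2 * N ^+ 2
   + 96 * B * L ^+ 2 * N ^+ 2
   + 6 * L ^+ 2 * Lx * N ^+ 2
   + 8 * L ^+ 2 * N ^+ 2
   + 60 * B * L ^+ 2 * N ^+ 2 * lam ^+ 2
   + 72 * B * L ^+ 2 * Lx * N ^+ 2
   + 12 * Lx ^+ 2 * N
   + 9 * Lx ^+ 2 * N * lam ^+ 2
   + 18 * Lx * N
   + 15 * N * lam ^+ 2
   + 24 * N
   + 2).

Definition Gc : R := N / 2 *
  ((1 + lam ^+ 2) *
     (72 * B ^+ 3 * nC ^+ 4 * L ^+ 2 * Lx * Ly * N * m
      + 72 * B * nC ^+ 2 * L ^+ 2 * Lx * Ly * N
      + 36 * B ^+ 3 * nC ^+ 6 * L ^+ 2 * Ly ^+ 2 * N * m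
      + 36 * B ^+ 3 * nC ^+ 2 * L ^+ 2 * Lx ^+ 2 * N * m
      + 36 * B * nC ^+ 4 * L ^+ 2 * Ly ^+ 2 * N
      + 36 * B * L ^+ 2 * Lx ^+ 2 * N)
   + 3 * B ^+ 2 * nC ^+ 6 * L ^+ 2 * Ly ^+ 2 * N * m
   + nC ^+ 4 *
     (72 * B ^+ 3 * L ^+ 2 * Ly * N * m
      + 6 * B ^+ 2 * L ^+ 2 * Lx * Ly * N * m
      + 6 * B ^+ 2 * L ^+ 2 * Ly * N * m
      + 3 * B ^+ 2 * Ly ^+ 2 * m
      + 3 * L ^+ 2 * Ly ^+ 2 * N)
   + nC ^+ 2 *
     (96 * B ^+ 3 * L ^+ 2 * N * m
      + 72 * B ^+ 3 * L ^+ 2 * Lx * N * m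
      + 72 * B * L ^+ 2 * Ly * N
      + 60 * B ^+ 3 * L ^+ 2 * N * lam ^+ 2 * m
      + 8 * B ^+ 2 * L ^+ 2 * N * m
      + 6 * B ^+ 2 * L ^+ 2 * Lx * N * m
      + 6 * L ^+ 2 * Lx * Ly * N
      + 6 * L ^+ 2 * Ly * N
      + 3 * B ^+ 2 * L ^+ 2 * Lx ^+ 2 * N * m
      + B * Ly * N)
   + 96 * B * L ^+ 2 * N
   + 72 * B * L ^+ 2 * Lx * N
   + 60 * B * L ^+ 2 * N * lam ^+ 2
   + 8 * L ^+ 2 * N
   + 6 * L ^+ 2 * Lx * N
   + 3 * Lx ^+ 2
   + 3 * L ^+ 2 * Lx ^+ 2 * N
   + B * Lx).

Definition cc : R := Dc / (2 * Fc + 2 * Dc).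

Definition rhoc : R := 1 - gamma * cc.

Definition ac : R :=
  Num.max (LJ * (1 + nC) * diamX)
          (8 * Ec * (Gc / Fc + Ec / Dc) * Fc / Dc * B * diamX ^+ 2).

Definition bc : R := Dc / (8 * Ec * (Gc / Fc + Ec / Dc) * Fc) * ac.

Definition dc : R := B ^+ 2 * m * nC ^+ 2 * bc.

(* Depends on gamma through Dc. *)
Definition gamma_max : R :=
  let h := ac / bc + 2 * Ec + Dc * cc in
  foldr Num.min (1 / 2)
    [:: 2 / ((3 * N + 1) * B * Lx + (3 * N ^+ 2 + 1) * B * nC ^+ 2 * Ly);
        2 / ((1 + B) * Lx + (1 + B * N) * nC ^+ 2 * Ly);
        Dc / Ec;
        (Gc / Fc + Ec / Dc)^-1;
        1 / (2 * cc);
        Dc / (8 * Fc * (Gc / Fc + Ec / Dc) * cc);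
        (h - Num.sqrt (h ^+ 2 - 4 * Dc * Ec * cc)) / (2 * Ec * cc)].

End Constants.

(* Main.v *)
Require Import Defs.
From HB Require Import structures.
From mathcomp Require Import all_boot all_order all_algebra.
From mathcomp Require Import all_classical all_reals all_analysis.
From mathcomp Require Import zify ring lra.

(** Write s(k) = x(k+1) - x(k) for the joint step of the agents, so that beta(k)
    is the energy of the last B steps. The proof compares consecutive windows of
    length B through two inequalities, valid at every time k.

    Descent ([window_descent]):
      alpha(k+B) + (D/gamma - E) beta(k+B) <= alpha(k) + E beta(k).
    Every agent moves against a gradient evaluated at stale data. The obtuse
    angle property of projections turns its move into a decrease |s_i|^2/gamma of
    the linearized objective. Staleness costs at most (Lx + N |C|^2 Ly) times the
    length of the path travelled during the last B steps, because a block of age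
    at most B lies within that distance of the current one ([stale_grad_le]).
    Products |s_i| |s(t)| are split into squares, which are charged to the two
    windows.

    Gap ([gap_window]):
      gamma^2 alpha(k+B) <= F (2/5 beta(k+B) + 1/5 beta(k)).
    Freeze each agent at its last computation in the window: z = x(k+B) is then a
    projected step from the vector xh of the blocks just before these
    computations. By convexity alpha(k+B) is at most the slope at z towards the
    minimizer, and the projection bounds this slope by |z - xh|/gamma plus the
    staleness. The remaining factor |z - x*| comes from the error bound at xh,
    whose residual is the step z - xh up to staleness again ([gap_le]). The first
    condition on the stepsize makes gamma N B (Lx + N |C|^2 Ly) at most 2/3, so
    that only absolute constants and powers of lambda remain, and F dominates
    them: F >= 15/2 lambda^2 + 13.

    Adding rho times the first inequality (scaled by gamma) and c times the
    second one shows that V = gamma alpha + (D/2) beta shrinks by the factor rho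
    from one window to the next ([lyapunov_rate]). The recursion starts at time
    0, where no step has been made yet: beta(0) = 0 and V(0) = gamma alpha(0) is
    at most gamma a, since J is Lipschitz. This bounds alpha. For beta, the
    descent inequality gives
      (D - E gamma) beta(k+B) <= gamma (alpha(k) + E beta(k)),
    and the seventh term of gamma_max, the smaller root of a quadratic, is chosen
    so that gamma (a/b + E) <= (D - E gamma) rho.

    Finally, a measured output changes by C applied to the path travelled since
    the previous measurement. These stretches do not overlap and have length less
    than B, so delta is at most (B - 1) m |C|^2 times the energy of two windows
    ([output_energy]). As rho >= 1/2, that energy is at most 3 b rho^(r-1), and
    3 (B - 1) <= B^2. *)

Set Implicit Arguments.
Unset Strict Implicit.
Unset Printing Implicit Defensive.

Import Order.TTheory GRing.Theory Num.Theory.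
Import numFieldNormedType.Exports.

Local Open Scope classical_set_scope.
Local Open Scope ring_scope.

(** * Euclidean inner product and norm *)

Section Euclid.
Variable R : realType.

Definition dot n (u v : 'cV[R]_n) : R := \sum_i u i 0 * v i 0.

Lemma dotE n (u v : 'cV[R]_n) : dot u v = (u^T *m v) 0 0.
Proof. by rewrite mxE; apply: eq_bigr => i _; rewrite mxE. Qed.

Lemma dotC n (u v : 'cV[R]_n) : dot u v = dot v u.
Proof. by apply: eq_bigr => i _; rewrite mulrC. Qed.

Lemma dotDr n (u v w : 'cV[R]_n) : dot u (v + w) = dot u v + dot u w.
Proof. by rewrite !dotE mulmxDr mxE. Qed.

Lemma dotDl n (u v w : 'cV[R]_n) : dot (v + w) u = dot v u + dot w u.
Proof. by rewrite dotC dotDr !(dotC u). Qed.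

Lemma dotNr n (u v : 'cV[R]_n) : dot u (- v) = - dot u v.
Proof. by rewrite !dotE mulmxN mxE. Qed.

Lemma dotNl n (u v : 'cV[R]_n) : dot (- v) u = - dot v u.
Proof. by rewrite dotC dotNr dotC. Qed.

Lemma dotZr n a (u v : 'cV[R]_n) : dot u (a *: v) = a * dot u v.
Proof. by rewrite !dotE -scalemxAr mxE. Qed.

Lemma dotZl n a (u v : 'cV[R]_n) : dot (a *: v) u = a * dot v u.
Proof. by rewrite dotC dotZr dotC. Qed.

Definition dotLE := (dotDl, dotDr, dotNl, dotNr, dotZl, dotZr).

Lemma dot_trmx n k (A : 'M[R]_(n, k)) u v : dot (A *m u) v = dot u (A^T *m v).
Proof. by rewrite !dotE trmx_mul mulmxA. Qed.

Lemma enorm_ge0 n (u : 'cV[R]_n) : 0 <= enorm u.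
Proof. exact: sqrtr_ge0. Qed.

Lemma sqr_enorm n (u : 'cV[R]_n) : enorm u ^+ 2 = dot u u.
Proof.
rewrite sqr_sqrtr; last by apply: sumr_ge0 => i _; apply: sqr_ge0.
by apply: eq_bigr => i _; rewrite expr2.
Qed.

Lemma ler_enorm_sqr n k (u : 'cV[R]_n) (v : 'cV[R]_k) :
  (enorm u <= enorm v) = (enorm u ^+ 2 <= enorm v ^+ 2).
Proof. by rewrite ler_pXn2r // nnegrE enorm_ge0. Qed.

Lemma enorm_le n (u : 'cV[R]_n) a : 0 <= a -> enorm u ^+ 2 <= a ^+ 2 -> enorm u <= a.
Proof. by move=> a0; rewrite ler_pXn2r // nnegrE enorm_ge0. Qed.

Lemma enorm0 n : enorm (0 : 'cV[R]_n) = 0.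
Proof.
by rewrite /enorm big1 ?sqrtr0 // => i _; rewrite mxE expr0n.
Qed.

Lemma enorm_eq0 n (u : 'cV[R]_n) : enorm u = 0 -> u = 0.
Proof.
move=> u0; have := sqr_enorm u; rewrite u0 expr0n /= => /esym /eqP.
rewrite psumr_eq0 => [/allP h|i _]; last by rewrite -expr2 sqr_ge0.
apply/matrixP => i j; rewrite !mxE ord1.
by have := h i (mem_index_enum _); rewrite mulf_eq0 orbb => /eqP.
Qed.

Lemma enormZ n a (u : 'cV[R]_n) : enorm (a *: u) = `|a| * enorm u.
Proof.
apply/eqP; rewrite -(@eqrXn2 _ 2) ?mulr_ge0 ?enorm_ge0 //.
by rewrite exprMn !sqr_enorm dotZl dotZr real_normK ?num_real // mulrA expr2.
Qed.

Lemma enormN n (u : 'cV[R]_n) : enorm (- u) = enorm u.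
Proof. by rewrite -scaleN1r enormZ normrN normr1 mul1r. Qed.

Lemma enormB_sym n (u v : 'cV[R]_n) : enorm (u - v) = enorm (v - u).
Proof. by rewrite -enormN opprB. Qed.

(** Cauchy-Schwarz: expand the squared norm of |v| u - |u| v. *)
Lemma dot_le n (u v : 'cV[R]_n) : dot u v <= enorm u * enorm v.
Proof.
have [u0|u0] := eqVneq (enorm u) 0.
  by rewrite u0 mul0r (enorm_eq0 u0) dotE trmx0 mul0mx mxE.
have [v0|v0] := eqVneq (enorm v) 0.
  by rewrite v0 mulr0 (enorm_eq0 v0) dotE mulmx0 mxE.
have pu : 0 < enorm u by rewrite lt_def u0 enorm_ge0.
have pv : 0 < enorm v by rewrite lt_def v0 enorm_ge0.
have := sqr_ge0 (enorm (enorm v *: u - enorm u *: v)).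
rewrite sqr_enorm !dotLE -!sqr_enorm (dotC v u).
set d := dot u v; set a := enorm u in pu *; set b := enorm v in pv *.
move=> h; have : 0 <= 2 * (a * b) * (a * b - d) by nra.
by rewrite pmulr_rge0 ?subr_ge0 // !mulr_gt0.
Qed.

Lemma enormD n (u v : 'cV[R]_n) : enorm (u + v) <= enorm u + enorm v.
Proof.
apply: enorm_le; first by rewrite addr_ge0 ?enorm_ge0.
rewrite sqr_enorm !dotLE (dotC v u) -!sqr_enorm.
by have := dot_le u v; nra.
Qed.

Lemma enormB n (u v : 'cV[R]_n) : enorm (u - v) <= enorm u + enorm v.
Proof. by rewrite -(enormN v) enormD. Qed.

Lemma enorm_coord n (u : 'cV[R]_n) i : `|u i 0| <= enorm u.
Proof.
rewrite -sqrtr_sqr ler_sqrt; last by apply: sumr_ge0 => j _; apply: sqr_ge0.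
by rewrite (bigD1 i) //= lerDl sumr_ge0 // => j _; apply: sqr_ge0.
Qed.

Lemma enorm_le_sum n (u : 'cV[R]_n) : enorm u <= \sum_i `|u i 0|.
Proof.
apply: enorm_le; first by apply: sumr_ge0.
rewrite sqr_enorm expr2 mulr_suml ler_sum // => i _.
rewrite -expr2 -real_normK ?num_real // expr2 ler_wpM2l //.
by rewrite (bigD1 i) //= lerDl sumr_ge0.
Qed.

Lemma sqr_enorm_col_mx n k (u : 'cV[R]_n) (v : 'cV[R]_k) :
  enorm (col_mx u v) ^+ 2 = enorm u ^+ 2 + enorm v ^+ 2.
Proof.
rewrite !sqr_enorm /dot big_split_ord /=.
by congr (_ + _); apply: eq_bigr => i _; rewrite (col_mxEu, col_mxEd).
Qed.

(** * Operator norm *)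

(** Row by row: every coordinate of A v is an inner product with v. *)
Lemma opnorm_ub n k (A : 'M[R]_(k, n)) :
  has_ubound [set enorm (A *m v) | v in [set v : 'cV[R]_n | enorm v <= 1]].
Proof.
exists (\sum_i enorm (row i A)^T) => _ [v /= v1 <-].
apply: le_trans (enorm_le_sum _) _; apply: ler_sum => i _.
have -> : (A *m v) i 0 = dot (row i A)^T v.
  by rewrite mxE; apply: eq_bigr => j _; rewrite !mxE.
have h : forall u : 'cV[R]_n, dot u v <= enorm u.
  move=> u; apply: le_trans (dot_le _ _) _.
  by rewrite ler_piMr ?enorm_ge0.
rewrite ler_norml h andbT lerNl -dotNl.
by apply: le_trans (h _) _; rewrite enormN.
Qed.

Lemma opnorm_ge0 n k (A : 'M[R]_(k, n)) : 0 <= opnorm A.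
Proof.
apply: (le_trans _ (ub_le_sup (opnorm_ub A) _)); last first.
  by exists 0 => //=; rewrite enorm0 ler01.
by rewrite mulmx0 enorm0.
Qed.

Lemma enorm_mulmx n k (A : 'M[R]_(k, n)) v : enorm (A *m v) <= opnorm A * enorm v.
Proof.
have [v0|v0] := eqVneq (enorm v) 0.
  by rewrite (enorm_eq0 v0) mulmx0 !enorm0 mulr0.
have pv : 0 < enorm v by rewrite lt_def v0 enorm_ge0.
rewrite -ler_pdivrMr // -[X in _ / X]ger0_norm ?enorm_ge0 // mulrC -normfV -enormZ.
rewrite scalemxAr; apply: ub_le_sup; first exact: opnorm_ub.
by exists ((enorm v)^-1 *: v) => //=; rewrite enormZ normfV ger0_norm ?enorm_ge0 // mulVf.
Qed.

(** By duality: |A^T w|^2 is the inner product of A (A^T w) with w. *)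
Lemma enorm_trmx_mul n k (A : 'M[R]_(k, n)) w :
  enorm (A^T *m w) <= opnorm A * enorm w.
Proof.
have [v0|v0] := eqVneq (enorm (A^T *m w)) 0.
  by rewrite v0 mulr_ge0 ?enorm_ge0 ?opnorm_ge0.
have pv : 0 < enorm (A^T *m w) by rewrite lt_def v0 enorm_ge0.
rewrite -(ler_pM2l pv) -expr2 sqr_enorm -dot_trmx.
apply: le_trans (dot_le _ _) _; rewrite mulrA ler_wpM2r ?enorm_ge0 //.
by rewrite mulrC enorm_mulmx.
Qed.

(** An empty vector has norm 0; otherwise the factor n is at least 1. *)
Lemma sqr_enorm_le_dim n (u : 'cV[R]_n) a :
  enorm u <= a -> enorm u ^+ 2 <= n%:R * a ^+ 2.
Proof.
case: n u => [|n] u ua; first by rewrite mul0r sqr_enorm /dot big_ord0.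
apply: (@le_trans _ _ (a ^+ 2)); last by rewrite ler_peMl ?sqr_ge0 // ler1n.
by rewrite ler_pXn2r ?nnegrE ?enorm_ge0 // (le_trans (enorm_ge0 u)).
Qed.

(** * Block vectors *)

Section Blocks.
Variables (N : nat) (p_ : 'I_N -> nat).
Local Notation sp := (\sum_i p_ i)%N.

Lemma dot_blocks (u v : 'cV[R]_sp) :
  dot u v = \sum_i dot (submxcol u i) (submxcol v i).
Proof.
rewrite dotE -{1}(submxcolK u) -{1}(submxcolK v) tr_mxcol mul_mxrow_mxcol summxE.
by apply: eq_bigr => i _; rewrite dotE.
Qed.

Lemma sqr_enorm_blocks (u : 'cV[R]_sp) :
  enorm u ^+ 2 = \sum_i enorm (submxcol u i) ^+ 2.
Proof. by rewrite sqr_enorm dot_blocks; apply: eq_bigr => i _; rewrite sqr_enorm. Qed.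

Lemma enorm_block (u : 'cV[R]_sp) i : enorm (submxcol u i) <= enorm u.
Proof.
rewrite ler_enorm_sqr sqr_enorm_blocks (bigD1 i) //= lerDl sumr_ge0 // => j _.
exact: sqr_ge0.
Qed.

Lemma enorm_le_blocks (u : 'cV[R]_sp) : enorm u <= \sum_i enorm (submxcol u i).
Proof.
have s0 : 0 <= \sum_i enorm (submxcol u i).
  by apply: sumr_ge0 => i _; apply: enorm_ge0.
apply: enorm_le => //; rewrite sqr_enorm_blocks expr2 mulr_suml ler_sum // => i _.
rewrite expr2 ler_wpM2l ?enorm_ge0 // (bigD1 i) //= lerDl sumr_ge0 // => j _.
exact: enorm_ge0.
Qed.

Lemma ler_enorm_blocks (u v : 'cV[R]_sp) :
  (forall i, enorm (submxcol u i) <= enorm (submxcol v i)) -> enorm u <= enorm v.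
Proof.
move=> h; rewrite ler_enorm_sqr !sqr_enorm_blocks ler_sum // => i _.
by rewrite -ler_enorm_sqr.
Qed.

Lemma sqr_enorm_block_mulmx n (A : 'M[R]_(sp, n)) (v : 'cV[R]_n) i :
  enorm (submxcol A i *m v) ^+ 2 <= (p_ i)%:R * opnorm A ^+ 2 * enorm v ^+ 2.
Proof.
rewrite -mulrA -exprMn; apply: sqr_enorm_le_dim.
rewrite submxcol_mul; exact: le_trans (enorm_block _ _) (enorm_mulmx _ _).
Qed.

End Blocks.

End Euclid.

(** * Gradients along segments *)

Section Calculus.
Variable R : realType.

Lemma derive_grad n (F : 'cV[R]_n -> R) x v :
  differentiable F x -> 'D_v F x = dot (grad F x) v.
Proof.
move=> dF; rewrite deriveE //.
rewrite {1}[v]matrix_sum_delta linear_sum; apply: eq_bigr => i _.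
by rewrite big_ord1 linearZ /= -deriveE // mxE mulrC.
Qed.

(** The difference quotients in t are literally those of the directional
    derivative at x + t v. *)
Lemma is_derive_line n (F : 'cV[R]_n -> R) x v (t : R) :
  differentiable F (x + t *: v) ->
  is_derive t 1 (fun s : R => F (x + s *: v)) (dot (grad F (x + t *: v)) v).
Proof.
move=> dF; rewrite -derive_grad //.
have e : (fun h : R =>
    h^-1 *: (((fun s : R => F (x + s *: v)) \o shift t) (h *: 1) - F (x + t *: v)))
   = (fun h : R => h^-1 *: ((F \o shift (x + t *: v)) (h *: v) - F (x + t *: v))).
  apply/funext => h /=; congr (_ *: (F _ - _)).
  by rewrite [h *: 1]mulr1 scalerDl addrCA addrA.
have := @diff_derivable _ _ _ F (x + t *: v) v dF; rewrite /derivable -e => cv.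
by split; [exact: cv | rewrite /derive e].
Qed.

Lemma line_MVT n (F : 'cV[R]_n -> R) x v :
  (forall z, differentiable F z) ->
  exists2 t : R, 0 <= t <= 1 & F (x + v) - F x = dot (grad F (x + t *: v)) v.
Proof.
move=> dF.
have dl t := is_derive_line (dF (x + t *: v)).
have [|t t01 h] := @MVT R (fun s : R => F (x + s *: v)) _ 0 1 ltr01 (fun t _ => dl t).
  apply: derivable_within_continuous => t _; exact: (@ex_derive _ _ _ _ _ _ _ (dl t)).
exists t; first by rewrite !ltW ?(itvP t01).
by move: h; rewrite subr0 mulr1 scale1r scale0r addr0.
Qed.

(** The first-order form of convexity, as the limit at 0 of the chord slopes. *)
Lemma convex_grad_le n (p : R) (F : 'cV[R]_n -> R) x y :
  0 <= p -> strongly_convex p F -> differentiable F x ->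
  F x + dot (grad F x) (y - x) <= F y.
Proof.
move=> p0 cF dF; rewrite addrC -lerBrDr -derive_grad //.
have cv := @diff_derivable _ _ _ F x (y - x) dF; rewrite /derivable in cv.
have cvr := cvg_dnbhs_at_right cv.
rewrite /derive (cvg_at_rightE _ _ cv); apply: limr_le; first exact: cvgP cvr.
near=> h; have h0 : 0 < h by near: h; exact: nbhs_right_gt.
have h1 : h <= 1 by near: h; apply: nbhs_right_le; exact: ltr01.
rewrite /= [_ *: _]mulrC ler_pdivrMr //.
have -> : h *: (y - x) + x = h *: y + (1 - h) *: x.
  by rewrite scalerBr scalerBl scale1r -addrA [- _ + x]addrC.
have := cF y x h; rewrite (ltW h0) h1 => /(_ isT).
have : 0 <= p / 2 * h * (1 - h) * enorm (y - x) ^+ 2.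
  by rewrite mulr_ge0 ?sqr_ge0 ?mulr_ge0 ?subr_ge0 ?invr_ge0 ?ler0n ?(ltW h0).
move: (p / 2 * _ * _ * _) => q; lra.
Unshelve. all: by end_near. Qed.

(** The mean value theorem for the scalar function z -> grad F z . w, where w is
    the difference of the two gradients itself; this avoids an integral of the
    Hessian along the segment. *)
Lemma grad_lipschitz n (F : 'cV[R]_n -> R) (l : R) x y :
  twice_continuously_differentiable F ->
  (forall t : R, 0 <= t <= 1 -> opnorm (hess F (y + t *: (x - y))) <= l) ->
  enorm (grad F x - grad F y) <= l * enorm (x - y).
Proof.
move=> [dF dgF _] hl; set v := x - y; set w := grad F x - grad F y.
have [w0|w0] := eqVneq (enorm w) 0.
  rewrite w0 mulr_ge0 ?enorm_ge0 //; apply: le_trans (hl 0 _).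
    exact: opnorm_ge0.
  by rewrite lexx ler01.
have pw : 0 < enorm w by rewrite lt_def w0 enorm_ge0.
rewrite -(ler_pM2l pw) -expr2 sqr_enorm.
have dc i z : differentiable (fun z => grad F z i 0) z.
  exact: (differentiable_comp (dgF z) (differentiable_coord _ _ _)).
pose G := fun z => dot (grad F z) w.
have GE : G = \sum_i (w i 0 *: (fun z => grad F z i 0)).
  by apply/funext => z; rewrite fct_sumE; apply: eq_bigr => i _; rewrite mulrC.
have dG z : differentiable G z.
  by rewrite GE; apply: differentiable_sum => i; apply: differentiableZ.
have gradG z : dot (grad G z) v = dot (hess F z *m v) w.
  rewrite -derive_grad // GE derive_sum => [|i]; last first.
    by apply: diff_derivable; apply: differentiableZ.
  apply: eq_bigr => i _; rewrite deriveZ; last exact: diff_derivable.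
  rewrite derive_grad // mulrC; congr (_ * _).
  by rewrite mxE; apply: eq_bigr => j _; rewrite !mxE.
have [t t01] := line_MVT y v dG; rewrite gradG [y + v]addrC subrK /G -dotNl -dotDl => ->.
apply: le_trans (dot_le _ _) _; rewrite mulrC ler_wpM2l ?enorm_ge0 //.
by apply: le_trans (enorm_mulmx _ _) _; rewrite ler_wpM2r ?enorm_ge0 ?hl.
Qed.

(** The remainder s -> F (x + s v) - s (grad F x . v) - s^2 l |v|^2 / 2 is
    nonincreasing on [0, 1]. *)
Lemma quadratic_upper_bound n (F : 'cV[R]_n -> R) (l : R) x v :
  (forall z, differentiable F z) ->
  (forall t : R, 0 <= t <= 1 ->
     enorm (grad F (x + t *: v) - grad F x) <= l * enorm (t *: v)) ->
  F (x + v) <= F x + dot (grad F x) v + l / 2 * enorm v ^+ 2.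
Proof.
move=> dF hl; set c := dot (grad F x) v.
pose q : R := l / 2 * enorm v ^+ 2.
pose psi := fun s : R => F (x + s *: v) - s * c - s ^+ 2 * q.
have dl (t : R) : is_derive t (1 : R) psi (dot (grad F (x + t *: v)) v - c - 2 * t * q).
  have h := is_derive_line (dF (x + t *: v)).
  by apply: is_derive_eq; rewrite /GRing.scale /=; ring.
have [|t t01] := @MVT R psi _ 0 1 ltr01 (fun t _ => dl t).
  apply: derivable_within_continuous => t _; exact: (@ex_derive _ _ _ _ _ _ _ (dl t)).
have {}t01 : 0 <= t <= 1 by rewrite !ltW ?(itvP t01).
rewrite /psi !scale1r !scale0r !addr0 => h.
suff : dot (grad F (x + t *: v)) v - c <= 2 * t * q.
  by move: h; rewrite -/q; move: (dot _ _) => d; lra.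
rewrite -dotNl -dotDl; apply: le_trans (dot_le _ _) _.
apply: (le_trans (ler_wpM2r (enorm_ge0 _) (hl t t01))).
by rewrite enormZ ger0_norm ?(andP t01).1 // /q; nra.
Qed.

End Calculus.

(** * Minimizers and projections on compact sets *)

Section Projection.
Variable R : realType.

Lemma mx_continuous (V : topologicalType) m n (M : V -> 'M[R]_(m, n)) :
  (forall i j, continuous (fun x => M x i j)) -> continuous M.
Proof.
move=> cM x; apply/cvgrPdist_le => e e0.
near=> z; rewrite /Num.Def.normr /= mx_normrE (bigmax_le _ (ltW e0)) //= => i _.
rewrite !mxE; move: i; near: z; apply: filter_forall => /= i.
exact: ((cvgrPdist_le _ _).1 (cM i.1 i.2 x)).
Unshelve. all: by end_near. Qed.

Lemma mulmx_continuous m n p (A : 'M[R]_(m, n)) :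
  continuous (fun M : 'M[R]_(n, p) => A *m M).
Proof.
apply: mx_continuous => i j.
have -> : (fun M : 'M[R]_(n, p) => (A *m M) i j) =
    \sum_k (A i k *: (fun M : 'M[R]_(n, p) => M k j)).
  by apply/funext => M; rewrite mxE fct_sumE.
move=> M; apply: differentiable_continuous; apply: differentiable_sum => k.
by apply: differentiableZ; apply: differentiable_coord.
Qed.

Lemma enorm_continuous n : continuous (@enorm R n).
Proof.
move=> x; apply: (@continuous_comp _ _ _ (fun v : 'cV[R]_n => \sum_i v i 0 ^+ 2) Num.sqrt);
  last exact: sqrt_continuous.
have -> : (fun v : 'cV[R]_n => \sum_i v i 0 ^+ 2) = \sum_i (fun v : 'cV[R]_n => v i 0 ^+ 2).
  by apply/funext => v; rewrite fct_sumE.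
apply: differentiable_continuous; apply: differentiable_sum => i.
rewrite (_ : (fun _ => _) = (fun v : 'cV[R]_n => v i 0) * (fun v => v i 0)).
  by apply: differentiableM; apply: differentiable_coord.
by apply/funext => v; rewrite expr2.
Qed.

(** The transpose of A is a closed subset of a box of row vectors. *)
Lemma cV_bounded_closed_compact n (A : set 'cV[R]_n) M :
  (forall x, A x -> enorm x <= M) -> closed A -> compact A.
Proof.
move=> bA cA.
have trc p q : continuous (@trmx R p q).
  apply: mx_continuous => i j.
  have -> : (fun M : 'M[R]_(p, q) => M^T i j) = fun M => M j i.
    by apply/funext => M'; rewrite mxE.
  exact: coord_continuous.
have -> : A = trmx @` ((trmx : 'rV[R]_n -> 'cV[R]_n) @^-1` A).
  apply/seteqP; split=> [x Ax|_ [x Ax <-] //].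
  by exists x^T => //=; rewrite ?trmxK.
apply: continuous_compact; first exact/continuous_subspaceT/trc.
set K := [set v : 'rV[R]_n | forall i, v ord0 i \in `[- M, M]].
have Kc : compact K.
  apply: (@rV_compact _  _ (fun=> `[- M, M]%classic)).
  by move=> _; apply: segment_compact.
apply: subclosed_compact Kc _; first by move/continuous_closedP : (@trc 1%N n); apply.
move=> v /= /bA vM i; rewrite in_itv /= -ler_norml.
by have := enorm_coord v^T i; rewrite mxE; move=> /le_trans; apply.
Qed.

Lemma compact_enorm_bounded n (A : set 'cV[R]_n) :
  compact A -> exists M, forall x, A x -> enorm x <= M.
Proof.
move=> cA; have [->|/set0P A0] := eqVneq A set0; first by exists 0.
have [c _ h] := compact_EVT_max A0 cA (continuous_subspaceT (@enorm_continuous n)).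
by exists (enorm c) => x Ax; apply: h; rewrite inE.
Qed.

Lemma enorm_sub_le_diameter n (A : set 'cV[R]_n) x y :
  compact A -> A x -> A y -> enorm (x - y) <= diameter A.
Proof.
move=> /compact_enorm_bounded [M hM] Ax Ay.
apply: ub_le_sup; last by exists (x, y).
exists (M + M) => _ [[u v] [/= Au Av] <-].
by apply: le_trans (enormB _ _) _; rewrite lerD ?hM.
Qed.

Lemma argminP n (Z : set 'cV[R]_n) (F : 'cV[R]_n -> R) :
  Z !=set0 -> compact Z -> continuous F ->
  Z (argmin Z F) /\ forall w, Z w -> F (argmin Z F) <= F w.
Proof.
move=> Z0 cZ cF.
have [c Zc h] := compact_EVT_min Z0 cZ (continuous_subspaceT cF).
apply: (@getPex _ [set z | Z z /\ forall w, Z w -> F z <= F w]).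
exists c; split; first by rewrite inE in Zc.
by move=> w Zw; apply: h; rewrite inE.
Qed.

Lemma euclid_projP n (Z : set 'cV[R]_n) v :
  Z !=set0 -> compact Z ->
  Z (euclid_proj Z v) /\
  forall w, Z w -> enorm (v - euclid_proj Z v) <= enorm (v - w).
Proof.
move=> Z0 cZ; apply: (@argminP _ Z (fun w => enorm (v - w))) => // x.
apply: (@continuous_comp _ _ _ (fun w : 'cV[R]_n => v - w) (@enorm R n));
  last exact: enorm_continuous.
by apply: continuousB; [exact: cst_continuous | exact: cvg_id].
Qed.

Definition convex_subset n (Z : set 'cV[R]_n) :=
  forall x y (t : R), Z x -> Z y -> 0 <= t <= 1 -> Z (y + t *: (x - y)).

Lemma polyhedral_convex n (Z : set 'cV[R]_n) : polyhedral Z -> convex_subset Z.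
Proof.
move=> [q [A [b ->]]] x y t /= Zx Zy /andP[t0 t1] i.
rewrite mulmxDr -scalemxAr mulmxBr !mxE.
have := Zx i; have := Zy i; rewrite !mxE.
set u := \sum_j _; set v := \sum_j _ => hu hv; nra.
Qed.

(** If the angle were acute, a small step from the projection towards w would
    come closer to v. *)
Lemma euclid_proj_obtuse n (Z : set 'cV[R]_n) v w :
  Z !=set0 -> compact Z -> convex_subset Z -> Z w ->
  dot (v - euclid_proj Z v) (w - euclid_proj Z v) <= 0.
Proof.
move=> Z0 cZ xZ Zw; have [ZP hP] := euclid_projP v Z0 cZ.
set P := euclid_proj Z v in ZP hP *; set d := dot _ _.
rewrite leNgt; apply/negP => d0.
pose e := enorm (w - P) ^+ 2; have e0 : 0 <= e by exact: sqr_ge0.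
(* This step length gives t e < 2 d, which makes the new distance smaller. *)
pose t := d / (d + e); have de : 0 < d + e by lra.
have t0 : 0 < t by rewrite divr_gt0.
have t1 : t <= 1 by rewrite ler_pdivrMr // mul1r; lra.
have := hP _ (xZ w P t Zw ZP _); rewrite (ltW t0) t1 => /(_ isT).
rewrite opprD addrA ler_enorm_sqr [leRHS]sqr_enorm.
move: @d @e @t d0 e0 de t0 t1; set u := w - P; set a := v - P => d e t d0 e0 de t0 t1.
clearbody u a.
rewrite !dotLE (dotC u) -!sqr_enorm -/d -/e => h.
have te : t * (d + e) = d by rewrite mulfVK // gt_eqF.
nra.
Qed.

Section Blocks.
Variables (N : nat) (p_ : 'I_N -> nat) (X_ : forall i, set 'cV[R]_(p_ i)).
Arguments X_ : clear implicits.
Let X := block_prod X_.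

Lemma block_prod_mxcol (x_ : forall i, 'cV[R]_(p_ i)) :
  (forall i, X_ i (x_ i)) -> X (\mxcol_i x_ i).
Proof. by move=> h i; rewrite mxcolK. Qed.

Lemma block_prod_nonempty : (forall i, X_ i !=set0) -> X !=set0.
Proof.
move=> h; exists (\mxcol_i projT1 (cid (h i))).
by apply: block_prod_mxcol => i; exact: projT2 (cid (h i)).
Qed.

Lemma block_prod_convex : (forall i, convex_subset (X_ i)) -> convex_subset X.
Proof.
move=> h x y t Xx Xy t01 i; rewrite submxcolD.
have -> : submxcol (t *: (x - y)) i = t *: (submxcol x i - submxcol y i).
  by apply/matrixP => j k; rewrite !mxE.
exact: h.
Qed.

Lemma block_prod_compact : (forall i, compact (X_ i)) -> compact X.
Proof.
move=> h.
pose M i := projT1 (cid (compact_enorm_bounded (h i))).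
have hM i x : X_ i x -> enorm x <= M i.
  exact: projT2 (cid (compact_enorm_bounded (h i))) x.
apply: (@cV_bounded_closed_compact _ _ (\sum_i M i)).
  move=> x Xx; apply: le_trans (enorm_le_blocks _) _.
  by apply: ler_sum => i _; exact: hM.
have -> : X = \bigcap_(i in setT) ((fun x => submxcol x i) @^-1` X_ i).
  by apply/seteqP; split=> x Xx i; [move=> _; exact: Xx | exact: (Xx i I)].
apply: closed_bigI => i _.
have : continuous (fun x : 'cV[R]_(\sum_i p_ i) => submxcol x i).
  apply: mx_continuous => j k.
  have -> : (fun x : 'cV[R]_(\sum_i p_ i) => submxcol x i j k) =
      fun x => x (tagnat.Rank i j) k by apply/funext => x; rewrite mxE.
  exact: coord_continuous.
move/continuous_closedP; apply; apply: compact_closed; [exact: norm_hausdorff | exact: h].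
Qed.

End Blocks.
End Projection.

(** * Sums over a window of times *)

Section Windows.
Variables (R : realType) (w : nat -> R).

Definition wsum l k := \sum_(l <= t < k) w t.
Definition wsum2 l k := \sum_(l <= t < k) w t ^+ 2.

Lemma wsum2_ge0 l k : 0 <= wsum2 l k.
Proof. by apply: sumr_ge0 => t _; exact: sqr_ge0. Qed.

Lemma wsum2_cat l j k : (l <= j)%N -> (j <= k)%N ->
  wsum2 l k = wsum2 l j + wsum2 j k.
Proof. by move=> lj jk; rewrite /wsum2 (big_cat_nat lj jk). Qed.

Lemma wsum2_sub l' l k k' : (l' <= l)%N -> (k <= k')%N ->
  wsum2 l k <= wsum2 l' k'.
Proof.
move=> ll kk; have [lk|kl] := leqP l k; last first.
  by rewrite {1}/wsum2 big_geq ?wsum2_ge0 // ltnW.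
rewrite (@wsum2_cat l' l k') //; last exact: leq_trans kk.
by rewrite (@wsum2_cat l k k') // addrCA lerDl addr_ge0 ?wsum2_ge0.
Qed.

Lemma wsum_sub l' l k : (forall t, 0 <= w t) -> (l' <= l)%N ->
  wsum l k <= wsum l' k.
Proof.
move=> w0 ll; have s0 a b : 0 <= wsum a b by apply: sumr_ge0.
have [lk|kl] := leqP l k; last by rewrite {1}/wsum big_geq ?s0 // ltnW.
by rewrite [leRHS](big_cat_nat ll lk) /= lerDr; exact: s0.
Qed.

Lemma mul_wsum_le a l k :
  a * wsum l k <= ((k - l)%:R * a ^+ 2 + wsum2 l k) / 2.
Proof.
have -> : (k - l)%:R * a ^+ 2 = \sum_(l <= t < k) a ^+ 2.
  by rewrite big_const_nat iter_addr_0 mulr_natl.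
rewrite /wsum2 -big_split /= mulr_suml mulr_sumr ler_sum // => t _.
by have := sqr_ge0 (a - w t); rewrite sqrrB; lra.
Qed.

Lemma sqr_wsum_le l k : wsum l k ^+ 2 <= (k - l)%:R * wsum2 l k.
Proof.
have [lk|kl] := leqP l k; last first.
  by rewrite /wsum big_geq ?expr0n ?mulr_ge0 ?wsum2_ge0 //= ltnW.
elim: k lk => [|k IH].
  by rewrite leqn0 => /eqP->; rewrite /wsum big_geq // expr0n mulr_ge0 ?wsum2_ge0.
rewrite leq_eqVlt => /predU1P[->|].
  by rewrite /wsum big_geq // expr0n mulr_ge0 ?wsum2_ge0.
rewrite ltnS => lk; have := IH lk; have := mul_wsum_le (w k) l k.
rewrite /wsum /wsum2 !big_nat_recr //= -/(wsum l k) -/(wsum2 l k) subSn // -[(k - l).+1%:R]natr1.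
move: ((k - l)%:R) => n; lra.
Qed.

End Windows.

(** * Distance to optimality after a projected step *)

Section Gap.
Variable R : realType.

(** Here z is the projection of xh - gam gv, where gv is a stale gradient, and P
    is the projection of xh - gam gh with the exact gradient gh at xh. The slope
    gz . (z - xs) is controlled by two errors, the step (z - xh) / gam and the
    staleness gz - gv. The distance from z to xs comes from the error bound at
    xh, whose residual xh - P differs from the step xh - z by at most
    gam |gv - gh|, since projections are nonexpansive. *)
Lemma gap_le n (gz gh gv z xh xs P : 'cV[R]_n) (gap gam lam l : R) :
  0 < gam <= 1 / 2 -> 0 <= lam -> gam * l <= 2 / 3 ->
  gap <= dot gz (z - xs) ->
  dot (xh - gam *: gv - z) (xs - z) <= 0 ->
  dot (xh - gam *: gv - z) (P - z) <= 0 ->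
  dot (xh - gam *: gh - P) (z - P) <= 0 ->
  enorm (xh - xs) <= lam * Num.max 1 gam^-1 * enorm (xh - P) ->
  enorm (gz - gh) <= l * enorm (z - xh) ->
  let u := enorm (z - xh) in let v := gam * enorm (gz - gv) in
  gam ^+ 2 * gap <= (v + u) * (u / 2 + lam * (5 / 3 * u + v)).
Proof.
move=> /andP[g0 g12] lam0 gl hgap vi1 vi2 vi3 eb lip /=.
set u := enorm (z - xh); set v := gam * enorm (gz - gv).
have u0 : 0 <= u by exact: enorm_ge0.
have v0 : 0 <= v by rewrite mulr_ge0 ?enorm_ge0 // ltW.
have gap1 : gam * gap <= (v + u) * enorm (z - xs).
  apply: (@le_trans _ _ (dot (gam *: (gz - gv)) (z - xs) + dot (xh - z) (z - xs))).
    have := ler_wpM2l (ltW g0) hgap; move: vi1.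
    rewrite -(opprB z xs) dotNr.
    have -> : xh - gam *: gv - z = (xh - z) - gam *: gv by rewrite addrAC.
    by rewrite !(dotDl _ (_ - _)) !dotNl !dotZl dotDl dotNl; lra.
  rewrite mulrDl lerD //; apply: le_trans (dot_le _ _) _.
    by rewrite enormZ ger0_norm // ltW.
  by rewrite enormB_sym.
have zP : enorm (z - P) <= gam * enorm (gv - gh).
  have [e0|e0] := eqVneq (enorm (z - P)) 0.
    by rewrite e0 mulr_ge0 ?enorm_ge0 // ltW.
  have pe : 0 < enorm (z - P) by rewrite lt_def e0 enorm_ge0.
  rewrite -(ler_pM2r pe) -expr2 enormB_sym sqr_enorm.
  have {1}-> : P - z = gam *: (gv - gh) + ((xh - gam *: gv - z) - (xh - gam *: gh - P)).
    by apply/matrixP => i j; rewrite !mxE; ring.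
  rewrite [gam * _](_ : _ = enorm (gam *: (gv - gh))); last by rewrite enormZ ger0_norm // ltW.
  apply: le_trans (dot_le _ _); rewrite dotDl -[leRHS]addr0 lerD2l dotDl dotNl.
  by move: vi3; rewrite -(opprB P z) dotNr; lra.
have ghv : gam * enorm (gv - gh) <= v + 2 / 3 * u.
  have h1 : enorm (gv - gh) <= enorm (gz - gv) + l * u.
    have -> : gv - gh = - (gz - gv) + (gz - gh) by rewrite opprB addrA subrK.
    by apply: le_trans (enormD _ _) _; rewrite enormN lerD.
  apply: (le_trans (ler_wpM2l (ltW g0) h1)); rewrite mulrDr lerD // mulrA.
  by rewrite ler_wpM2r.
have zx : gam * enorm (z - xs) <= u / 2 + lam * (5 / 3 * u + v).
  have t1 : enorm (z - xs) <= u + enorm (xh - xs).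
    by have := enormD (z - xh) (xh - xs); rewrite addrA subrK.
  have t2 : enorm (xh - P) <= u + enorm (z - P).
    by have := enormD (xh - z) (z - P); rewrite addrA subrK [enorm (xh - z)]enormB_sym.
  have mx : Num.max 1 gam^-1 = gam^-1.
    by apply/max_idPr; rewrite -invr1 lef_pV2 ?posrE //; lra.
  have t3 : gam * enorm (xh - xs) <= lam * enorm (xh - P).
    rewrite -ler_pdivlMl // mulrA [_^-1 * _]mulrC; move: eb; rewrite mx.
    by [].
  have t4 : lam * enorm (xh - P) <= lam * (5 / 3 * u + v).
    by rewrite ler_wpM2l //; lra.
  have t5 := ler_wpM2l (ltW g0) t1.
  have t6 : gam * u <= 1 / 2 * u by rewrite ler_wpM2r.
  by lra.
have := ler_wpM2l (ltW g0) gap1; rewrite mulrA -expr2 => /le_trans; apply.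
by rewrite mulrCA ler_wpM2l // addr_ge0.
Qed.

(** Young's inequality for the bound of [gap_le]; the constants 2/5 and 1/5 are
    small enough for the contraction in [lyapunov_rate]. *)
Lemma gap_bound (u v lam b1 b2 F y : R) :
  u ^+ 2 <= b1 -> v ^+ 2 <= 8 / 9 * (b1 + b2) -> 0 <= b2 -> 0 <= lam ->
  15 / 2 * lam ^+ 2 + 13 <= F ->
  y <= (v + u) * (u / 2 + lam * (5 / 3 * u + v)) ->
  y <= F * (2 / 5 * b1 + 1 / 5 * b2).
Proof.
move=> hu hv b20 lam0 hF; move/le_trans; apply.
have b10 : 0 <= b1 by apply: le_trans hu; exact: sqr_ge0.
have uv : 2 * (u * v) <= u ^+ 2 + v ^+ 2.
  by have := sqr_ge0 (u - v); rewrite sqrrB; lra.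
have s0 : 0 <= 2 / 5 * b1 + 1 / 5 * b2 by lra.
apply: le_trans (ler_wpM2r s0 hF).
have i1 : (v + u) * (u / 2) <= b1 + 1 / 4 * b2.
  have -> : (v + u) * (u / 2) = (u * v + u ^+ 2) / 2 by ring.
  lra.
have i2 : (v + u) * (5 / 3 * u + v) <= 26 / 5 * b1 + 21 / 10 * b2.
  have -> : (v + u) * (5 / 3 * u + v) = 5 / 3 * u ^+ 2 + 8 / 3 * (u * v) + v ^+ 2 by field.
  lra.
have i3 : lam * ((v + u) * (5 / 3 * u + v)) <=
      (lam ^+ 2 + 1) / 2 * (26 / 5 * b1 + 21 / 10 * b2).
  have l1 : lam <= (lam ^+ 2 + 1) / 2.
    by have := sqr_ge0 (lam - 1); rewrite sqrrB; lra.
  apply: (le_trans (ler_wpM2l lam0 i2)); apply: ler_wpM2r => //; lra.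
have p1 : 0 <= lam ^+ 2 * b1 by rewrite mulr_ge0 ?sqr_ge0.
have p2 : 0 <= lam ^+ 2 * b2 by rewrite mulr_ge0 ?sqr_ge0.
rewrite mulrDr mulrCA; lra.
Qed.

End Gap.

(** * Contraction of the window recursion *)

Section Rate.
Variable R : realType.

(** The combination gam al + (D / 2) be shrinks by rho = 1 - gam c: adding c
    times the second recursion to rho times the first one restores the full
    weight rho + gam c = 1 of al r.+1, and leaves at least D / 2 on be r.+1 and
    at most rho D / 2 on be r. It starts from gam al 0, because be 0 = 0. *)
Lemma lyapunov_rate (al be : nat -> R) (D E F c gam a b : R) :
  0 < gam -> 0 < D -> 0 < E -> 0 <= c ->
  c * F <= D / 2 -> gam * E <= 27 / 100 * D -> 0 <= gam * c <= 1 / 50 ->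
  0 <= b -> gam * (a + E * b) <= (D - E * gam) * (1 - gam * c) * b ->
  (forall r, 0 <= al r) -> (forall r, 0 <= be r) ->
  al 0%N <= a -> be 0%N = 0 ->
  (forall r, gam * al r.+1 + (D - E * gam) * be r.+1 <= gam * al r + E * gam * be r) ->
  (forall r, gam ^+ 2 * al r.+1 <= F * (2 / 5 * be r.+1 + 1 / 5 * be r)) ->
  forall r, al r <= a * (1 - gam * c) ^+ r /\ be r.+1 <= b * (1 - gam * c) ^+ r.
Proof.
move=> g0 D0 E0 c0 cF gE /andP[gc0 gc1] b0 hb al0 be0 ala be00 h1 h2.
set rho := 1 - gam * c in hb *.
have rho0 : 0 < rho by rewrite /rho; lra.
have rho1 : rho <= 1 by rewrite /rho; lra.
have rr0 r : 0 < rho ^+ r by rewrite exprn_gt0.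
pose V r := gam * al r + D / 2 * be r.
have VS r : V r.+1 <= rho * V r.
  have := h1 r; have := h2 r; rewrite /V.
  move: (al r.+1) (al r) (be r.+1) (be r) (al0 r.+1) (al0 r) (be0 r.+1) (be0 r).
  move=> a1 a2 b1 b2 pa1 pa2 pb1 pb2 k2 k1.
  have i2 : gam * (gam * c) * a1 <= D * (1 / 5 * b1 + 1 / 10 * b2).
    have : c * (gam ^+ 2 * a1) <= c * (F * (2 / 5 * b1 + 1 / 5 * b2)) by rewrite ler_wpM2l.
    have : c * F * (2 / 5 * b1 + 1 / 5 * b2) <= D / 2 * (2 / 5 * b1 + 1 / 5 * b2).
      by apply: ler_wpM2r => //; lra.
    by nra.
  have i1 := ler_wpM2l (ltW rho0) k1.
  have j1 : D / 2 * b1 <= (rho * (D - E * gam) - D / 5) * b1.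
    by apply: ler_wpM2r => //; rewrite /rho; nra.
  have j2 : (rho * (E * gam) + D / 10) * b2 <= rho * (D / 2) * b2.
    by apply: ler_wpM2r => //; rewrite /rho; nra.
  rewrite /rho in i1 j1 j2 *; nra.
have Vr r : V r <= gam * a * rho ^+ r.
  elim: r => [|r IH].
    by rewrite /V be00 expr0 mulr0 mulr1 addr0 ler_wpM2l // ltW.
  apply: le_trans (VS r) _; rewrite exprS mulrCA.
  by rewrite ler_wpM2l // ltW.
have alr r : al r <= a * rho ^+ r.
  rewrite -(ler_pM2l g0) mulrA; apply: le_trans (Vr r).
  by rewrite /V lerDl mulr_ge0 // divr_ge0 // ltW.
have dE : 0 < D - E * gam by lra.
(* Multiplied by rho, the bound on be r also makes sense, and holds, for r = 0. *)
have ber r : be r * rho <= b * rho ^+ r.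
  elim: r => [|r IH]; first by rewrite be00 mul0r mulr1.
  rewrite -(ler_pM2l dE).
  have k1 : (D - E * gam) * be r.+1 <= gam * al r + E * gam * be r.
    by apply: le_trans (h1 r); rewrite lerDr mulr_ge0 // ltW.
  have k2 := ler_wpM2r (ltW rho0) k1.
  have k3 : gam * al r * rho <= gam * a * rho ^+ r.
    have k30 : gam * al r * rho <= gam * al r by rewrite ler_piMr // mulr_ge0 // ltW.
    by apply: le_trans k30 _; rewrite -mulrA ler_wpM2l // ltW.
  have k4 := ler_wpM2l (mulr_ge0 (ltW E0) (ltW g0)) IH.
  have k5 := ler_wpM2r (ltW (rr0 r)) hb.
  rewrite exprS; move: (rho ^+ r) k3 k4 k5 k2 => q; nra.
move=> r; split; first exact: alr.
by rewrite -(ler_pM2r rho0) -mulrA -exprSr.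
Qed.

End Rate.

(** * Consequences of the stepsize conditions *)

Section ConstantBounds.
Variables (R : realType) (N B m nC L LJ Lx Ly lam diamX gam : R).

Local Ltac pos :=
  match goal with
  | |- is_true (0 < _ + _) => apply: addr_gt0; pos
  | |- is_true (0 < _ * _) => apply: mulr_gt0; pos
  | |- is_true (0 < _%:R) => by rewrite ltr0n
  | |- is_true (0 < _ ^-1) => rewrite invr_gt0; pos
  | |- is_true (0 < 1) => exact: ltr01
  | |- is_true (0 <= _ + _) => apply: addr_ge0; pos
  | |- is_true (0 <= _ * _) => apply: mulr_ge0; pos
  | |- is_true (0 <= _ ^-1) => rewrite invr_ge0; pos
  | |- is_true (0 <= _ ^+ 2) => exact: sqr_ge0
  | |- is_true (0 <= _ ^+ _) => apply: exprn_ge0; pos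
  | |- is_true (0 <= _%:R) => exact: ler0n
  | |- is_true (0 <= 1) => exact: ler01
  | |- _ => first [assumption | exact: ltW]
  end.

Lemma Ec_gt0 : 0 < N -> 0 < B -> 0 < Lx -> 0 < Ly -> 0 < Ec N B nC Lx Ly.
Proof.
move=> N0 B0 Lx0 Ly0; rewrite /Ec !mulr_gt0 ?invr_gt0 ?ltr0n //.
by apply: ltr_wpDr => //; pos.
Qed.

(** From the summands 15 N lam^2, 24 N and 2 of F. *)
Lemma Fc_ge : 1 <= N -> 0 <= B -> 0 <= m -> 0 <= nC -> 0 < Lx -> 0 < Ly ->
  15 / 2 * lam ^+ 2 + 13 <= Fc N B m nC L Lx Ly lam.
Proof.
move=> N1 B0 m0 nC0 Lx0 Ly0; have N0 : 0 < N := lt_le_trans ltr01 N1.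
have lN : lam ^+ 2 <= N * lam ^+ 2 by rewrite ler_peMl ?sqr_ge0.
rewrite /Fc; set s0 := (X in X + 15 * N * lam ^+ 2).
have s00 : 0 <= s0 by rewrite /s0; pos.
move: s0 s00 => s0 s00; lra.
Qed.

Lemma Gc_ge0 : 0 <= N -> 0 <= B -> 0 <= m -> 0 <= nC -> 0 < Lx -> 0 < Ly ->
  0 <= Gc N B m nC L Lx Ly lam.
Proof. by move=> N0 B0 m0 nC0 Lx0 Ly0; rewrite /Gc; pos. Qed.

Hypothesis (N1 : 1 <= N) (B1 : 1 <= B) (m0 : 0 <= m) (nC0 : 0 <= nC)
  (Lx0 : 0 < Lx) (Ly0 : 0 < Ly) (LJ0 : 0 < LJ) (diam0 : 0 <= diamX).
Let D := Dc N B nC Lx Ly gam.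
Let E := Ec N B nC Lx Ly.
Let F := Fc N B m nC L Lx Ly lam.
Let G := Gc N B m nC L Lx Ly lam.
Let c := cc N B m nC L Lx Ly lam gam.
Let a := ac N B m nC L LJ Lx Ly lam diamX gam.
Let b := bc N B m nC L LJ Lx Ly lam diamX gam.

(** The bounds of the first bracket come, in order, from the constant term 1/2 of
    [gamma_max], from its second term, from its first term, from its sixth term,
    where F (G / F + E / D) >= F E / D and c F >= 13 D / 28, and from the size of
    c, at most 1/26 as D <= 1 and F >= 13. The final inequality is the quadratic
    condition D - gam h + E c gam^2 >= 0 multiplied by b, where
    h = a / b + 2 E + D c and gam lies below the smaller root, the seventh term. *)
Lemma stepsize_bounds :
  0 < gam < gamma_max N B m nC L LJ Lx Ly lam diamX gam ->
  [/\ 0 < gam <= 1 / 2, 0 < D, gam * (N * B * (Lx + N * nC ^+ 2 * Ly)) <= 2 / 3,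
      gam * E <= 27 / 100 * D & 0 < gam * c <= 1 / 50] /\
  [/\ 0 < c, c * F <= D / 2, 0 <= b
    & gam * (a + E * b) <= (D - E * gam) * (1 - gam * c) * b].
Proof.
have N0 : 0 < N := lt_le_trans ltr01 N1.
have B0 : 0 < B := lt_le_trans ltr01 B1.
have E0 : 0 < E by exact: Ec_gt0.
have F13 : 13 <= F.
  apply: le_trans (Fc_ge N1 (ltW B0) m0 nC0 Lx0 Ly0).
  by rewrite lerDr mulr_ge0 ?sqr_ge0.
have G0 : 0 <= G by apply: Gc_ge0 => //; exact: ltW.
have a0 : 0 <= a.
  by rewrite le_max; apply/orP; left; pos.
have bE : b = D / (8 * E * (G / F + E / D) * F) * a by [].
have cE : c = D / (2 * F + 2 * D) by [].
move=> /andP[g0]; rewrite /gamma_max /= !lt_min -/D -/E -/F -/G -/a -/b -/c.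
case/and4P=> g1 g2 _ /and5P[_ _ g6 g7 g8].
have F0 : 0 < F by apply: lt_le_trans F13.
set w := nC ^+ 2 * Ly; have w0 : 0 <= w by apply: mulr_ge0; rewrite ?sqr_ge0 // ltW.
have gw : gam * ((3 * N + 1) * B * Lx + (3 * N ^+ 2 + 1) * B * w) < 2.
  rewrite -ltr_pdivlMr; first by rewrite /w mulrA.
  apply: ltr_wpDr; first by pos.
  by pos.
have D0 : 0 < D.
  rewrite /D /Dc mulr_gt0 ?invr_gt0 // subr_gt0 -mulrA -/w -ltr_pdivlMr; first by rewrite /w mulrA.
  apply: ltr_wpDr; first by pos.
  by pos.
have D1 : D <= 1.
  rewrite /D /Dc -mulrA -/w ler_pdivrMl // mulr1 gerBl.
  by pos.
have NB : gam * (N * B * (Lx + N * nC ^+ 2 * Ly)) <= 2 / 3.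
  rewrite -[N * nC ^+ 2 * Ly]mulrA -/w.
  have BL : 0 <= gam * (B * Lx + B * w) by pos.
  by move: w gw BL {w0} => w gw BL; lra.
move: (G / F) (E / D) (divr_ge0 G0 (ltW F0)) (divr_gt0 E0 D0) (divfK (lt0r_neq0 D0) E) bE g6 g7.
move=> GF ED GF0 ED0 EDE.
set H := GF + ED => bE g6 g7.
have H0 : 0 < H by rewrite ltr_wpDl.
have HE : E <= H * D by rewrite /H mulrDl EDE lerDr mulr_ge0 // ltW.
have c0 : 0 < c by rewrite cE divr_gt0 // addr_gt0 // mulr_gt0.
have cFD : c * F + c * D = D / 2.
  by rewrite cE; field; lra.
have cD0 : 0 < c * D by rewrite mulr_gt0.
have cF2 : c * F <= D / 2 by lra.
have cF1 : 13 * c <= c * F by rewrite mulrC ler_wpM2l // ltW.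
have cD : c * D <= c by rewrite ler_piMr // ltW.
clearbody D E F G c a b; clear G G0 GF0.
have c26 : c <= 1 / 26 by lra.
have gE : gam * E <= 27 / 100 * D.
  have : gam * (8 * F * H * c) < D by rewrite -ltr_pdivlMr // !mulr_gt0.
  have : 13 / 28 * D * (gam * E) <= c * F * (gam * (H * D)).
    apply: ler_pM; [lra | by rewrite mulr_ge0 ?ltW | lra |].
    by rewrite ler_wpM2l // ltW.
  move=> i1 i2; rewrite -(ler_pM2l D0).
  have i3 : D * (gam * (8 * F * H * c)) <= D * D by rewrite ler_wpM2l // ltW.
  by nra.
have k0 : 0 < D / (8 * E * H * F) by rewrite divr_gt0 // !mulr_gt0.
have b0 : 0 <= b by rewrite bE mulr_ge0 // ltW.
split; split=> //.
- by rewrite g0 ltW.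
- by rewrite mulr_gt0 //=; nra.
(* If a = 0 then b = 0 as well, and a / b does not cancel. *)
have [az|az] := eqVneq a 0.
  by rewrite bE az !(mulr0, addr0).
have ab : a / b * b = a by rewrite divfK // bE mulf_neq0 // gt_eqF.
move: (a / b) ab g7 => q <-.
set h := q + 2 * E + D * c => g7.
have Ec0 : 0 < E * c by rewrite mulr_gt0.
move: g7; rewrite ltr_pdivlMr; last by rewrite !mulr_gt0.
(* A negative discriminant would be harmless: its square root is 0. *)
set dis := h ^+ 2 - 4 * D * E * c; set x := Num.sqrt dis => g7.
have x0 : 0 <= x by exact: sqrtr_ge0.
have xd : dis <= x ^+ 2.
  by have [d0|d0] := leP 0 dis; [rewrite sqr_sqrtr | rewrite (le_trans (ltW d0)) ?sqr_ge0].
have y2 : x ^+ 2 <= (h - 2 * (E * c) * gam) ^+ 2.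
  have g7' : x <= h - 2 * (E * c) * gam by lra.
  by rewrite ler_pXn2r ?nnegrE // (le_trans x0 g7').
have : 0 <= 4 * (E * c) * (D - gam * h + E * c * gam ^+ 2).
  have := le_trans xd y2; rewrite /dis; lra.
rewrite pmulr_rge0; last by lra.
move=> /(mulr_ge0 b0); rewrite /h; lra.
Qed.

End ConstantBounds.

(** * The asynchronous trajectory *)

Section Trajectory.
Variables (R : realType) (N : nat) (n_ m_ : 'I_N -> nat).
Local Notation n := (\sum_i n_ i)%N.
Local Notation m := (\sum_i m_ i)%N.
Variables (C : 'M[R]_(m, n)) (f : 'cV[R]_n -> R) (g : 'cV[R]_m -> R).
Variables (X_ : forall i, set 'cV[R]_(n_ i)) (B : nat).
Arguments X_ : clear implicits.
Variables (S : schedule N) (T : trajectory R n_ m_) (gam Lx Ly : R).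
Let X := block_prod X_.
Let Lam := Lx + N%:R * opnorm C ^+ 2 * Ly.
Let sg t := enorm (xstep S T t).
Let x := xtrue T.
Let y := ytrue C T.

Hypothesis exec : executes C f g S T X_ gam.

Lemma sg_ge0 t : 0 <= sg t.
Proof. exact: enorm_ge0. Qed.

Lemma xtrue_block k i : submxcol (x k) i = xblk T i i k.
Proof. by rewrite mxcolK. Qed.

Lemma xstep_block k i : submxcol (xstep S T k) i = xblk T i i k.+1 - xblk T i i k.
Proof.
rewrite mxcolK; case: ifPn => // /negbTE nk.
by rewrite (exec_compute exec) nk subrr.
Qed.

Lemma xtrue_step k : x k.+1 = x k + xstep S T k.
Proof.
by apply/mxcolP => i; rewrite submxcolD !xtrue_block xstep_block addrC subrK.
Qed.

(** Blocks computed at different times in [l, k] differ from the current state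
    by at most the length of the path travelled in between. By induction on k,
    with the stamps capped at k: from k to k+1 the difference x - u changes only
    in the blocks whose stamp is at most k, and there by a block of the step. *)
Lemma stale_le (u : 'cV[R]_n) (tau : 'I_N -> nat) l k :
  (l <= k)%N -> (forall j, (l <= tau j <= k)%N) ->
  (forall j, submxcol u j = xblk T j j (tau j)) ->
  enorm (x k - u) <= wsum sg l k.
Proof.
elim: k u tau => [|k IH] u tau.
  rewrite leqn0 => /eqP -> ht hu.
  have -> : u = x 0%N.
    apply/mxcolP => j; rewrite hu xtrue_block.
    by have := ht j; rewrite leqn0 => /eqP ->.
  by rewrite subrr enorm0 /wsum big_geq.
rewrite leq_eqVlt => /predU1P[->|] ht hu.
  have -> : u = x k.+1.
    apply/mxcolP => j; rewrite hu xtrue_block.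
    by have := ht j; rewrite -eqn_leq => /eqP <-.
  by rewrite subrr enorm0 /wsum big_geq.
move=> hu'; rewrite ltnS in ht.
pose u' : 'cV[R]_n := \mxcol_j xblk T j j (minn (tau j) k).
have h1 : enorm (x k - u') <= wsum sg l k.
  apply: (IH u' (fun j => minn (tau j) k)) => // j; last by rewrite mxcolK.
  by have := hu j; lia.
have h2 : enorm ((x k.+1 - u) - (x k - u')) <= sg k.
  apply: ler_enorm_blocks => j.
  rewrite !submxcolB !xtrue_block hu' mxcolK xstep_block.
  have [tk|tk] := leqP (tau j) k; first by rewrite opprB addrA subrK.
  have -> : tau j = k.+1 by have := hu j; lia.
  by rewrite !subrr enorm0 enorm_ge0.
rewrite /wsum big_nat_recr //= -/(wsum sg l k).
by rewrite -[x k.+1 - u](subrK (x k - u')) addrC; apply: le_trans (enormD _ _) _; rewrite lerD.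
Qed.

Lemma xtrue_diff_le l k : (l <= k)%N -> enorm (x k - x l) <= wsum sg l k.
Proof.
move=> lk; apply: (@stale_le _ (fun=> l)) => // [j|j]; last exact: xtrue_block.
by rewrite leqnn.
Qed.

Hypothesis async : partially_asynchronous B S.

(** * Measured outputs *)

Lemma ystep_block k i : submxcol (ystep S T k) i = yblk T i i k.+1 - yblk T i i k.
Proof.
rewrite mxcolK; case: ifPn => // /negbTE nk.
by rewrite (exec_measure exec) nk subrr.
Qed.

(** A measurement replaces the output of some time l by the current one, where
    l >= k - B + 1, and the next measurement starts from there: the stretches
    [l, k) of different measurements do not overlap. The second summand on the
    left is the part of the budget that is reserved for the stretch in progress;
    a stamp that has become too old is replaced by the later one that partial
    asynchrony provides, which only shortens the stretch. *)
Lemma measured_energy i k d : exists l,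
  [/\ ((k + d).+1 - B <= l <= k + d)%N,
      yblk T i i (k + d) = submxcol C i *m x l &
      \sum_(k <= t < k + d) enorm (submxcol (ystep S T t) i) ^+ 2
        + B.-1%:R * ((m_ i)%:R * opnorm C ^+ 2) * wsum2 sg l (k + d)
      <= B.-1%:R * ((m_ i)%:R * opnorm C ^+ 2) * wsum2 sg (k - B) (k + d)].
Proof.
set w := B.-1%:R * _.
have w0 : 0 <= w by rewrite mulr_ge0 // mulr_ge0 ?sqr_ge0.
have [_ _ _ hy] := async.
elim: d => [|d [l [hl yl IH]]].
  exists (ystamp S i i k); rewrite addn0; split.
  - exact: hy.
  - by apply: (exec_ystamp exec).
  - rewrite big_geq // add0r ler_wpM2l // wsum2_sub //.
    by have := hy i i k; lia.
rewrite addnS; set K := (k + d)%N in hl yl IH *.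
have kK : (k <= K)%N by exact: leq_addr.
have Qr l' : (l' <= K)%N -> wsum2 sg l' K.+1 = wsum2 sg l' K + sg K ^+ 2.
  by move=> ?; rewrite /wsum2 big_nat_recr.
have [l1 [l1K yl1 h1]] : exists l1, [/\ (l1 <= K)%N,
    yblk T i i K.+1 = submxcol C i *m x l1 &
    \sum_(k <= t < K.+1) enorm (submxcol (ystep S T t) i) ^+ 2
        + w * wsum2 sg l1 K.+1 <= w * wsum2 sg (k - B) K.+1].
  have kBK : (k - B <= K)%N by rewrite (leq_trans (leq_subr _ _)).
  have [Ki|/negbTE Ki] := boolP (K \in measure_times S i).
    have yK : yblk T i i K.+1 = submxcol C i *m x K.
      by rewrite (exec_measure exec) Ki submxcol_mul.
    exists K; split=> //.
    have -> : wsum2 sg K K.+1 = sg K ^+ 2 by rewrite /wsum2 big_nat1.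
    rewrite (Qr (k - B)%N kBK) mulrDr.
    rewrite big_nat_recr //= lerD2r; apply: le_trans IH; rewrite lerD2l.
    rewrite ystep_block yK yl -mulmxBr; apply: le_trans (sqr_enorm_block_mulmx _ _ _) _.
    rewrite /w [leRHS]mulrAC [leRHS]mulrC.
    apply: ler_wpM2l; first by rewrite mulr_ge0 ?sqr_ge0.
    have lK : (l <= K)%N by have := hl; lia.
    apply: (@le_trans _ _ (wsum sg l K ^+ 2)).
      rewrite ler_pXn2r ?nnegrE ?enorm_ge0 ?xtrue_diff_le //.
      by apply: sumr_ge0 => t _; exact: enorm_ge0.
    apply: le_trans (sqr_wsum_le _ _ _) _; rewrite ler_wpM2r ?wsum2_ge0 // ler_nat.
    by have := hl; lia.
  have lK : (l <= K)%N by have := hl; lia.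
  exists l; split=> //; first by rewrite (exec_measure exec) Ki.
  rewrite big_nat_recr //= ystep_block (exec_measure exec) Ki subrr enorm0 expr0n addr0.
  by rewrite !Qr // !(mulrDr w) addrA lerD2r.
have [l1B|l1B] := leqP (K.+2 - B) l1.
  by exists l1; split=> //; rewrite l1B ltnW.
exists (ystamp S i i K.+1); split; [exact: hy | by apply: (exec_ystamp exec) |].
apply: le_trans h1; rewrite lerD2l ler_wpM2l // wsum2_sub //.
by have := hy i i K.+1; lia.
Qed.

Lemma output_energy k :
  delta_err S T B (k + B) <=
  B.-1%:R * (m%:R * opnorm C ^+ 2) * (wsum2 sg (k - B) k + wsum2 sg k (k + B)).
Proof.
rewrite -wsum2_cat ?leq_subr ?leq_addr // /delta_err addnK.
rewrite (eq_bigr _ (fun t _ => sqr_enorm_blocks (ystep S T t))) exchange_big /=.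
have -> : m%:R = \sum_i (m_ i)%:R :> R by rewrite natr_sum.
rewrite mulr_suml mulr_sumr mulr_suml ler_sum // => i _.
have [l [_ _]] := measured_energy i k B; apply: le_trans.
by rewrite lerDl mulr_ge0 ?wsum2_ge0 // mulr_ge0 // mulr_ge0 ?sqr_ge0.
Qed.

(** * Stale gradients *)

Hypothesis B0 : (0 < B)%N.
Hypothesis X_ne : forall i, X_ i !=set0.
Hypothesis X_compact : forall i, compact (X_ i).

Lemma own_block_in i k : X_ i (xblk T i i k).
Proof.
elim: k => [|k IH]; first exact: exec_init exec i.
rewrite (exec_compute exec); case: ifP => // _.
exact: (euclid_projP _ (X_ne i) (@X_compact i)).1.
Qed.

Lemma xtrue_in k : X (x k).
Proof. by move=> i; rewrite xtrue_block; exact: own_block_in. Qed.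

Lemma xagent_stamp i k : exists2 tau : 'I_N -> nat,
  forall j, (k.+1 - B <= tau j <= k)%N &
  forall j, submxcol (xagent T i k) j = xblk T j j (tau j).
Proof.
have [_ _ hx _] := async.
exists (fun j => if j == i then k else xstamp S i j k) => j.
  by case: ifP => // _; lia.
rewrite mxcolK; case: eqVneq => [-> //|ji]; exact: exec_xstamp exec i j k ji.
Qed.

Lemma xagent_in i k : X (xagent T i k).
Proof.
have [tau _ ht] := xagent_stamp i k => j.
by rewrite ht; exact: own_block_in.
Qed.

Lemma yagent_block i k j :
  submxcol (yagent T i k) j = submxcol C j *m x (ystamp S i j k).
Proof. by rewrite mxcolK; exact: exec_ystamp exec i j k. Qed.

Lemma yagent_in i k : mixed_output_set C X (yagent T i k).
Proof. by move=> j; exists (x (ystamp S i j k)); [exact: xtrue_in | exact: yagent_block]. Qed.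

Lemma output_in_mixed u : X u -> mixed_output_set C X (C *m u).
Proof. by move=> Xu j; exists u; rewrite ?submxcol_mul. Qed.

Lemma yagent_stale_le i l k : (l <= k)%N ->
  enorm (y k - yagent T i l) <= N%:R * opnorm C * wsum sg (l.+1 - B) k.
Proof.
move=> lk; apply: le_trans (enorm_le_blocks _) _.
apply: (@le_trans _ _ (\sum_(j < N) opnorm C * wsum sg (l.+1 - B) k)); last first.
  by rewrite sumr_const card_ord -mulrA mulr_natl.
apply: ler_sum => j _; rewrite submxcolB yagent_block submxcol_mul -submxcolB -mulmxBr.
apply: le_trans (enorm_block _ _) _.
apply: le_trans (enorm_mulmx _ _) _; rewrite ler_wpM2l ?opnorm_ge0 //.
have [_ _ _ /(_ i j l) /andP[h1 h2]] := async.
apply: le_trans (xtrue_diff_le (leq_trans h2 lk)) _.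
by apply: wsum_sub => // t; exact: sg_ge0.
Qed.

Hypothesis Lx0 : 0 <= Lx.
Hypothesis Ly0 : 0 <= Ly.
Hypothesis grad_f_lip : forall u v, X u -> X v ->
  enorm (grad f u - grad f v) <= Lx * enorm (u - v).
Hypothesis grad_g_lip : forall u v, mixed_output_set C X u -> mixed_output_set C X v ->
  enorm (grad g u - grad g v) <= Ly * enorm (u - v).

Lemma gradx_blockE i u v : gradx_block C f g i u v = submxcol (gradx C f g u v) i.
Proof.
rewrite submxcolD; congr (_ + _).
by rewrite tr_submxrow submxcol_mul.
Qed.

Lemma enorm_gradx_sub u v u' v' :
  enorm (gradx C f g u v - gradx C f g u' v') <=
  enorm (grad f u - grad f u') + opnorm C * enorm (grad g v - grad g v').
Proof.
rewrite /gradx opprD addrACA -mulmxBr; apply: le_trans (enormD _ _) _.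
by rewrite lerD2l enorm_trmx_mul.
Qed.

(** Both gradients are Lipschitz, and a mixed output vector is off by at most
    |C| times the path length in each of its N blocks. *)
Lemma stale_grad_le i l k : (l <= k)%N ->
  enorm (gradx_block C f g i (x k) (y k)
         - gradx_block C f g i (xagent T i l) (yagent T i l))
  <= Lam * wsum sg (l.+1 - B) k.
Proof.
move=> lk; rewrite !gradx_blockE -submxcolB; apply: le_trans (enorm_block _ _) _.
apply: le_trans (enorm_gradx_sub _ _ _ _) _.
rewrite /Lam mulrDl lerD //.
  apply: le_trans (grad_f_lip (xtrue_in k) (xagent_in i l)) _.
  rewrite ler_wpM2l //.
  have [tau h1 h2] := xagent_stamp i l.
  apply: (stale_le _ _ h2) => [|j]; first by lia.
  by have := h1 j; lia.
apply: le_trans (ler_wpM2l (opnorm_ge0 C)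
  (grad_g_lip (output_in_mixed (xtrue_in k)) (yagent_in i l))) _.
apply: le_trans (ler_wpM2l (opnorm_ge0 C) (ler_wpM2l Ly0 (yagent_stale_le i lk))) _.
by rewrite le_eqVlt; apply/orP; left; apply/eqP; ring.
Qed.

Hypothesis dff : forall u, differentiable f u.
Hypothesis dfg : forall u, differentiable g u.
Let J k := objective f g (x k) (y k).
Let kappa := Lx + opnorm C ^+ 2 * Ly.
Let gx k := gradx C f g (x k) (y k).
Let gs i k := gradx_block C f g i (xagent T i k) (yagent T i k).

Hypothesis X_convex : forall i, convex_subset (X_ i).
Hypothesis gam0 : 0 < gam.

Lemma segment_in k (t : R) : 0 <= t <= 1 -> X (x k + t *: xstep S T k).
Proof.
move=> t01.
have -> : xstep S T k = x k.+1 - x k by rewrite xtrue_step addrC addKr.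
by apply: (block_prod_convex (@X_convex)) => //; exact: xtrue_in.
Qed.

Lemma objective_descent k :
  J k.+1 <= J k + dot (gx k) (xstep S T k) + kappa / 2 * sg k ^+ 2.
Proof.
set v := xstep S T k.
have y1 : y k.+1 = y k + C *m v by rewrite /y /ytrue -mulmxDr -xtrue_step.
have hf : f (x k + v) <= f (x k) + dot (grad f (x k)) v + Lx / 2 * enorm v ^+ 2.
  apply: quadratic_upper_bound => // t t01.
  apply: le_trans (grad_f_lip (segment_in _ t01) (xtrue_in k)) _.
  by rewrite addrAC subrr add0r.
have hg : g (y k + C *m v) <=
    g (y k) + dot (grad g (y k)) (C *m v) + Ly / 2 * enorm (C *m v) ^+ 2.
  apply: quadratic_upper_bound => // t t01.
  have e : y k + t *: (C *m v) = C *m (x k + t *: v) by rewrite mulmxDr -scalemxAr.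
  apply: le_trans (grad_g_lip _ _) _.
  - by rewrite e; apply: output_in_mixed; exact: segment_in.
  - by apply: output_in_mixed; exact: xtrue_in.
  - by rewrite addrAC subrr add0r.
have hC : Ly / 2 * enorm (C *m v) ^+ 2 <= Ly / 2 * (opnorm C ^+ 2 * enorm v ^+ 2).
  rewrite ler_wpM2l ?divr_ge0 // -exprMn ler_pXn2r ?nnegrE ?mulr_ge0 ?enorm_ge0 ?opnorm_ge0 //.
  exact: enorm_mulmx.
rewrite /J /objective xtrue_step y1 /gx /gradx dotDl dot_trmx trmxK -/v /sg -/v /kappa.
lra.
Qed.

Lemma projected_step_obtuse i k w : k \in compute_times S i -> X_ i w ->
  dot (xblk T i i k - gam *: gs i k - xblk T i i k.+1) (w - xblk T i i k.+1) <= 0.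
Proof.
move=> ki Xw; rewrite (exec_compute exec) ki; apply: euclid_proj_obtuse => //.
Qed.

(** The obtuse angle between the projected step and the previous position, which
    belongs to the constraint set. *)
Lemma agent_step_descent i k :
  dot (gs i k) (submxcol (xstep S T k) i) <= - (enorm (submxcol (xstep S T k) i) ^+ 2 / gam).
Proof.
rewrite xstep_block; case: (boolP (k \in compute_times S i)) => [ki|/negbTE ki]; last first.
  by rewrite (exec_compute exec) ki subrr enorm0 expr0n mul0r oppr0 dotE mulmx0 mxE.
have := projected_step_obtuse ki (own_block_in i k).
set u := xblk T i i k.+1 - xblk T i i k.
rewrite -(opprB (xblk T i i k.+1) (xblk T i i k)) -/u dotNr.
have -> : xblk T i i k - gam *: gs i k - xblk T i i k.+1 = - u - gam *: gs i k.
  by rewrite /u opprB addrAC.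
rewrite dotDl !dotNl dotZl -sqr_enorm => h.
by rewrite lerNr ler_pdivrMr //; lra.
Qed.

Lemma Lam_ge0 : 0 <= Lam.
Proof. by rewrite addr_ge0 // mulr_ge0 // mulr_ge0 ?sqr_ge0. Qed.

(** Replacing the stale gradients by the exact one costs
    Lam |s_i(k)| times the length of the last steps, for each agent i. *)
Lemma step_descent k :
  J k.+1 <= J k - (gam^-1 - kappa / 2 - Lam * B%:R / 2) * sg k ^+ 2
            + Lam * N%:R / 2 * wsum2 sg (k.+1 - B) k.
Proof.
have Lam0 := Lam_ge0.
have h1 : dot (gx k) (xstep S T k) <=
    - (sg k ^+ 2 / gam) + Lam * ((B%:R * sg k ^+ 2 + N%:R * wsum2 sg (k.+1 - B) k) / 2).
  apply: (@le_trans _ _ (\sum_i (- (enorm (submxcol (xstep S T k) i) ^+ 2 / gam)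
      + Lam * (enorm (submxcol (xstep S T k) i) * wsum sg (k.+1 - B) k)))).
    rewrite dot_blocks; apply: ler_sum => i _.
    rewrite -[submxcol (gx k) i](subrK (gs i k)) dotDl addrC lerD ?agent_step_descent //.
    apply: le_trans (dot_le _ _) _; rewrite mulrCA [leRHS]mulrC.
    by rewrite ler_wpM2r ?enorm_ge0 // -gradx_blockE stale_grad_le.
  rewrite big_split /= sumrN -mulr_suml -sqr_enorm_blocks -/(sg k) lerD2l -mulr_sumr.
  rewrite ler_wpM2l //.
  apply: (@le_trans _ _ (\sum_(i < N) ((k - (k.+1 - B))%:R
       * enorm (submxcol (xstep S T k) i) ^+ 2 + wsum2 sg (k.+1 - B) k) / 2)).
    by apply: ler_sum => i _; exact: mul_wsum_le.
  rewrite -mulr_suml big_split /= -mulr_sumr -sqr_enorm_blocks -/(sg k) sumr_const card_ord.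
  rewrite ler_wpM2r ?invr_ge0 // -[_ *+ N]mulr_natl lerD2r ler_wpM2r ?sqr_ge0 // ler_nat; lia.
have := objective_descent k; rewrite -/(sg k) in h1 *; move: h1.
by move: (dot _ _) => d; rewrite mulrC; lra.
Qed.

(** Every energy on the right of [step_descent] is contained in the 2 B steps
    around k. *)
Lemma window_descent k :
  J (k + B)%N + (gam^-1 - kappa / 2 - Lam * B%:R / 2 - Lam * N%:R * B%:R / 2) * wsum2 sg k (k + B)
  <= J k + Lam * N%:R * B%:R / 2 * wsum2 sg (k - B) k.
Proof.
have Lam0 := Lam_ge0.
set dl := gam^-1 - kappa / 2 - Lam * B%:R / 2.
have h j : (j <= B)%N ->
    J (k + j)%N + dl * wsum2 sg k (k + j)
    <= J k + j%:R * (Lam * N%:R / 2 * wsum2 sg (k - B) (k + B)).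
  elim: j => [|j IH] jB; first by rewrite addn0 /wsum2 big_geq // mulr0 mul0r.
  have := IH (ltnW jB); have := step_descent (k + j); rewrite -/dl addnS.
  have : Lam * N%:R / 2 * wsum2 sg ((k + j).+1 - B) (k + j)
      <= Lam * N%:R / 2 * wsum2 sg (k - B) (k + B).
    by rewrite ler_wpM2l ?divr_ge0 ?mulr_ge0 // wsum2_sub //; lia.
  rewrite [wsum2 sg k (k + j).+1]/wsum2 big_nat_recr ?leq_addr //= -/(wsum2 sg k (k + j)).
  rewrite -[j.+1%:R]natr1; lra.
have := h B (leqnn _); rewrite (@wsum2_cat _ sg (k - B) k (k + B)) ?leq_addr ?leq_subr //; lra.
Qed.

Lemma last_compute i k : exists l, [/\ (k <= l < k + B)%N, l \in compute_times S i
  & xblk T i i l.+1 = xblk T i i (k + B)].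
Proof.
have [/(_ i k) [l0 l0i l0k] _ _ _] := async.
suff h d : (l0 + d.+1 <= k + B)%N -> exists l,
    [/\ (k <= l < k + B)%N, l \in compute_times S i & xblk T i i l.+1 = xblk T i i (l0 + d.+1)].
  have [|l hl] := h (k + B - l0.+1)%N; first lia.
  by exists l; move: hl; rewrite (_ : l0 + _ = k + B)%N //; lia.
elim: d => [|d IH] hd.
  by exists l0; split; [exact: l0k | rewrite inE | rewrite addn1].
have [ki|/negbTE ki] := boolP ((l0 + d.+1)%N \in compute_times S i).
  by exists (l0 + d.+1)%N; split=> //; [lia | rewrite -addnS].
have [|l [h1 h2 h3]] := IH; first lia.
by exists l; split=> //; rewrite h3 (addnS l0 d.+1) (exec_compute exec) ki.
Qed.

Lemma sqr_enorm_sum_steps i k l : (k <= l)%N -> (l < k + B)%N ->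
  enorm (submxcol (xstep S T l) i) ^+ 2 <=
  \sum_(k <= t < k + B) enorm (submxcol (xstep S T t) i) ^+ 2.
Proof.
move=> kl lB; rewrite (big_cat_nat kl (ltnW lB)) /= [X in _ + X]big_ltn //.
rewrite addrCA lerDl addr_ge0 //; apply: sumr_ge0 => t _; exact: sqr_ge0.
Qed.

(** Apply [gap_le] to z = x (k + B) and to the vector xh of the blocks before the
    last computation of each agent. As z is obtained from xh by these
    computations, |z - xh|^2 is part of the energy of the window. *)
Lemma gap_window k (xs : 'cV[R]_n) (lam F : R) :
  (0 < N)%N -> X xs ->
  (forall u, X u -> objective f g u (C *m u) - objective f g xs (C *m xs)
                    <= dot (gradx C f g u (C *m u)) (u - xs)) ->
  0 <= lam ->
  (forall u, X u -> enorm (u - xs) <= lam * Num.max 1 gam^-1 *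
     enorm (u - euclid_proj X (u - gam *: gradx C f g u (C *m u)))) ->
  gam <= 1 / 2 -> gam * (N%:R * B%:R * Lam) <= 2 / 3 ->
  15 / 2 * lam ^+ 2 + 13 <= F ->
  gam ^+ 2 * (J (k + B)%N - objective f g xs (C *m xs)) <=
  F * (2 / 5 * wsum2 sg k (k + B) + 1 / 5 * wsum2 sg (k - B) k).
Proof.
move=> N0 Xxs Jcvx lam0 eb g12 gNB hF.
have window_len : (k + B - (k - B) <= 2 * B)%N by lia.
have Lam0 := Lam_ge0; have g0 := gam0.
have N1 : 1 <= N%:R :> R by rewrite ler1n.
have B1 : 1 <= B%:R :> R by rewrite ler1n.
pose l i := projT1 (cid (last_compute i k)).
have hl i : [/\ (k <= l i < k + B)%N, l i \in compute_times S i
  & xblk T i i (l i).+1 = xblk T i i (k + B)] := projT2 (cid (last_compute i k)).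
set z := x (k + B).
pose xh : 'cV[R]_n := \mxcol_i xblk T i i (l i).
pose gv : 'cV[R]_n := \mxcol_i gs i (l i).
have Xz : X z by exact: xtrue_in.
have Xxh : X xh by move=> i; rewrite mxcolK; exact: own_block_in.
have vi w : X w -> dot (xh - gam *: gv - z) (w - z) <= 0.
  move=> Xw; rewrite dot_blocks; apply: sumr_le0 => i _.
  have [_ ki e] := hl i.
  have := projected_step_obtuse ki (Xw i); rewrite e.
  rewrite !submxcolB xtrue_block mxcolK.
  have -> : submxcol (gam *: gv) i = gam *: gs i (l i).
    by rewrite -[gs i _](mxcolK (fun i => gs i (l i))); apply/matrixP => a b; rewrite !mxE.
  by [].
have X_ne' : X !=set0 by exists xs.
have X_cp : compact X by apply: block_prod_compact.
set gh := gradx C f g xh (C *m xh).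
set P := euclid_proj X (xh - gam *: gh).
have [XP _] := euclid_projP (xh - gam *: gh) X_ne' X_cp; rewrite -/P in XP.
have viP : dot (xh - gam *: gh - P) (z - P) <= 0.
  by apply: euclid_proj_obtuse => //; apply: (block_prod_convex (@X_convex)).
have lipz : enorm (gx (k + B) - gh) <= kappa * enorm (z - xh).
  apply: le_trans (enorm_gradx_sub _ _ _ _) _; rewrite /kappa mulrDl lerD ?grad_f_lip //.
  have h := grad_g_lip (output_in_mixed Xz) (output_in_mixed Xxh).
  apply: le_trans (ler_wpM2l (opnorm_ge0 C) h) _.
  rewrite -mulmxBr [leRHS](_ : _ = opnorm C * (Ly * (opnorm C * enorm (z - xh)))).
    by rewrite !ler_wpM2l ?opnorm_ge0 // enorm_mulmx.
  by ring.
have kapLam : gam * kappa <= 2 / 3.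
  apply: le_trans gNB; rewrite ler_wpM2l ?(ltW gam0) //.
  have k1 : kappa <= Lam.
    by rewrite /kappa /Lam lerD2l -[leRHS]mulrA ler_peMl // mulr_ge0 ?sqr_ge0.
  apply: (le_trans k1); rewrite ler_peMl // mulr_ege1 //.
have hgap := gap_le _ lam0 kapLam (Jcvx z Xz) (vi _ Xxs) (vi _ XP) viP (eb xh Xxh) lipz.
apply: gap_bound (hgap _) => //; last by rewrite gam0.
- rewrite sqr_enorm_blocks.
  have -> : wsum2 sg k (k + B) = \sum_i \sum_(k <= t < k + B) enorm (submxcol (xstep S T t) i) ^+ 2.
    rewrite exchange_big /=; apply: eq_bigr => t _; exact: sqr_enorm_blocks.
  apply: ler_sum => i _; have [/andP[h1 h2] _ e] := hl i.
  apply: le_trans (sqr_enorm_sum_steps i h1 h2).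
  by rewrite submxcolB xtrue_block mxcolK xstep_block e.
- have hV : enorm (gx (k + B) - gv) ^+ 2
      <= N%:R * (Lam ^+ 2 * ((2 * B%:R) * wsum2 sg (k - B) (k + B))).
    rewrite sqr_enorm_blocks; set bnd := (X in _ <= _ * X).
    apply: (@le_trans _ _ (\sum_(i < N) bnd)); last by rewrite sumr_const card_ord mulr_natl.
    apply: ler_sum => i _.
    have [/andP[h1 h2] _ e] := hl i.
    apply: (@le_trans _ _ ((Lam * wsum sg (k - B) (k + B)) ^+ 2)).
      have V0 : 0 <= wsum sg (k - B) (k + B) by apply: sumr_ge0 => t _; exact: enorm_ge0.
      rewrite ler_pXn2r ?nnegrE ?enorm_ge0 ?mulr_ge0 //.
      rewrite submxcolB mxcolK -gradx_blockE.
      apply: le_trans (stale_grad_le i (ltnW h2)) _; rewrite ler_wpM2l // wsum_sub //.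
        by move=> t; exact: enorm_ge0.
      by rewrite leq_sub2r // leqW.
    rewrite exprMn ler_wpM2l ?sqr_ge0 //; apply: le_trans (sqr_wsum_le _ _ _) _.
    by rewrite ler_wpM2r ?wsum2_ge0 // -natrM ler_nat.
  rewrite exprMn; apply: le_trans (ler_wpM2l (sqr_ge0 gam) hV) _.
  rewrite (@wsum2_cat _ sg (k - B) k (k + B)) ?leq_addr ?leq_subr // [_ + wsum2 sg k _]addrC.
  set Q := _ + _; have Q0 : 0 <= Q by rewrite addr_ge0 ?wsum2_ge0.
  rewrite [leLHS](_ : _ = 2 * (gam * Lam) * (gam * (N%:R * B%:R * Lam)) * Q); last first.
    clearbody Lam Q; ring.
  rewrite ler_wpM2r //.
  have g1 : gam * Lam <= gam * (N%:R * B%:R * Lam).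
    by rewrite ler_wpM2l ?(ltW gam0) // ler_peMl // mulr_ege1.
  have g2 : 0 <= gam * Lam by rewrite mulr_ge0 // ltW.
  have g3 : gam * Lam * (gam * (N%:R * B%:R * Lam)) <= 2 / 3 * (2 / 3).
    by apply: ler_pM => //; [exact: le_trans g1 | exact: le_trans gNB].
  rewrite -mulrA; move: (_ * _) g3 => q; lra.
- exact: wsum2_ge0.
Qed.

End Trajectory.

(** * Linear convergence *)

Theorem theorem1 (R : realType) (N : nat) (n_ m_ : 'I_N -> nat)
    (C : 'M[R]_(\sum_i m_ i, \sum_i n_ i))
    (f : 'cV[R]_(\sum_i n_ i) -> nat -> R)
    (g : 'cV[R]_(\sum_i m_ i) -> nat -> R)
    (t0 : nat)
    (X_ : forall i : 'I_N, set 'cV[R]_(n_ i))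
    (p : R) (B : nat)
    (Lx Ly LJ L lam gamma : R)
    (S : schedule N) (T : trajectory R n_ m_) (r0 : nat) :
  let ft := fun x => f x t0 in
  let gt := fun y => g y t0 in
  let X := block_prod X_ in
  let Y := output_set C X in
  let J := objective ft gt in
  let gradJ := gradx C ft gt in
  let xstar := minimizer C ft gt X in
  let nN : R := N%:R in
  let nB : R := B%:R in
  let m : R := (\sum_i m_ i)%N%:R in
  let nC := opnorm C in
  let a := ac nN nB m nC L LJ Lx Ly lam (diameter X) gamma in
  let b := bc nN nB m nC L LJ Lx Ly lam (diameter X) gamma in
  let d := dc nN nB m nC L LJ Lx Ly lam (diameter X) gamma in
  let rho0 := rhoc nN nB m nC L Lx Ly lam gamma in
  (0 < N)%N -> (0 < B)%N -> (0 < r0)%N ->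
  (* assumption on the objective *)
  twice_continuously_differentiable ft ->
  twice_continuously_differentiable gt ->
  0 < p -> strongly_convex p ft -> strongly_convex p gt ->
  (* assumption on the constraints *)
  (forall i, [/\ X_ i !=set0, compact (X_ i) & polyhedral (X_ i)]) ->
  (* constants *)
  0 < Lx -> (forall x, X x -> opnorm (hess ft x) <= Lx) ->
  0 < Ly -> (forall y, Y y -> opnorm (hess gt y) <= Ly) ->
  (forall y y', mixed_output_set C X y -> mixed_output_set C X y' ->
     enorm (grad gt y - grad gt y') <= Ly * enorm (y - y')) ->
  0 < LJ ->
  (forall x y x' y', X x -> Y y -> X x' -> Y y' ->
     `|J x y - J x' y'| <= LJ * enorm (col_mx (x - x') (y - y'))) ->
  0 < L ->
  (forall x y x' y', X x -> Y y -> X x' -> Y y' ->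
     enorm (gradJ x y - gradJ x' y') <= L * enorm (col_mx (x - x') (y - y'))) ->
  0 < lam ->
  (forall x (e : R), X x -> 0 < e ->
     enorm (x - xstar) <=
     lam * Num.max 1 e^-1 *
       enorm (x - euclid_proj X (x - e *: gradJ x (C *m x)))) ->
  (* partial asynchrony, stepsize and execution of the algorithm *)
  partially_asynchronous B S ->
  0 < gamma < gamma_max nN nB m nC L LJ Lx Ly lam (diameter X) gamma ->
  executes C ft gt S T X_ gamma ->
  [/\ 0 < rho0 < 1,
      alpha_err C ft gt T X (r0 * B) <= a * rho0 ^+ (r0 - 1),
      beta_err S T B (r0 * B) <= b * rho0 ^+ (r0 - 1)
    & delta_err S T B (r0 * B) <= d * rho0 ^+ (r0 - 1)].
Proof.
move=> ft gt X Y J gradJ xstar nN nB m nC a b d rho0 N0 B0 r00 f2 g2 p0 fcv gcv hX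
  Lx0 hLx Ly0 _ hLg LJ0 hLJ _ _ lam0 eb async hgam exec.
have X_ne i : X_ i !=set0 by case: (hX i).
have X_cp i : compact (X_ i) by case: (hX i).
have X_cv i : convex_subset (X_ i) by apply: polyhedral_convex; case: (hX i).
have X0 : X !=set0 by exact: block_prod_nonempty.
have cX : compact X by exact: block_prod_compact.
have vX : convex_subset X by exact: block_prod_convex.
have [dff _ _] := f2; have [dfg _ _] := g2.
have grad_f_lip u v : X u -> X v -> enorm (grad ft u - grad ft v) <= Lx * enorm (u - v).
  by move=> Xu Xv; apply: grad_lipschitz => // t t01; apply: hLx; exact: vX.
have Jcont : continuous (fun u => objective ft gt u (C *m u)).
  move=> u; apply: continuousD; first exact/differentiable_continuous.
  apply: continuous_comp; first exact: mulmx_continuous.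
  exact/differentiable_continuous.
have [Xxs xs_min] := argminP X0 cX Jcont; rewrite -/(minimizer C ft gt X) -/xstar in Xxs xs_min.
have Jcvx u : X u -> objective ft gt u (C *m u) - objective ft gt xstar (C *m xstar)
    <= dot (gradx C ft gt u (C *m u)) (u - xstar).
  move=> _; have hf := convex_grad_le xstar (ltW p0) fcv (dff u).
  have hg := convex_grad_le (C *m xstar) (ltW p0) gcv (dfg (C *m u)).
  move: hf hg; rewrite -mulmxBr -(opprB u) mulmxN !dotNr /gradx dotDl dot_trmx trmxK /objective.
  lra.
have nN1 : 1 <= nN by rewrite ler1n.
have nB1 : 1 <= nB by rewrite ler1n.
have m0 : 0 <= m by exact: ler0n.
have nC0 : 0 <= nC by exact: opnorm_ge0.
have X0in : X (xtrue T 0%N) by exact: (xtrue_in exec).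
have diam0 : 0 <= diameter X.
  by apply: le_trans (enorm_sub_le_diameter cX Xxs Xxs); exact: enorm_ge0.
have [[/andP[g0 g12] D0 gNB gE /andP[gc0 gc1]] [c0 cF b0 hb]] :=
  stepsize_bounds nN1 nB1 m0 nC0 Lx0 Ly0 LJ0 diam0 hgam.
have F_ge : 15 / 2 * lam ^+ 2 + 13 <= Fc nN nB m nC L Lx Ly lam.
  by apply: Fc_ge => //; apply: le_trans nB1.
have E0 : 0 < Ec nN nB nC Lx Ly.
  by apply: Ec_gt0 => //; [apply: lt_le_trans nN1 | apply: lt_le_trans nB1].
pose al r := alpha_err C ft gt T X (r * B).
pose be r := beta_err S T B (r * B).
have al_ge0 r : 0 <= al r.
  by rewrite subr_ge0; apply: xs_min; exact: (xtrue_in exec).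
have be_ge0 r : 0 <= be r by apply: sumr_ge0 => t _; exact: sqr_ge0.
have be0 : be 0%N = 0 by rewrite /be /beta_err big_geq.
have al0 : al 0%N <= a.
  have Yin u : X u -> Y (C *m u) by exists u.
  have h := le_trans (ler_norm _) (hLJ _ _ _ _ X0in (Yin _ X0in) Xxs (Yin _ Xxs)).
  apply: le_trans h _; rewrite /a /ac le_max; apply/orP; left.
  rewrite -mulrA ler_wpM2l ?(ltW LJ0) // -mulmxBr.
  have hd := enorm_sub_le_diameter cX X0in Xxs.
  have hCd := le_trans (enorm_mulmx C (xtrue T 0%N - xstar)) (ler_wpM2l nC0 hd).
  rewrite mulrDl mul1r; set u := xtrue T 0%N - xstar in hd hCd *.
  apply: enorm_le; first by rewrite addr_ge0 ?mulr_ge0.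
  rewrite sqr_enorm_col_mx; have := enorm_ge0 u; have := enorm_ge0 (C *m u).
  move: (enorm u) (enorm (C *m u)) hd hCd (mulr_ge0 nC0 diam0).
  by move: (nC * diameter X) => ? ? ? ? ? ? ? ?; nra.
have succB r : (r.+1 * B = r * B + B)%N by rewrite mulSnr.
have beE r : be r.+1 = wsum2 (fun t => enorm (xstep S T t)) (r * B) (r * B + B).
  by rewrite /be /beta_err succB addnK.
have descent_al r :
    gamma * al r.+1 + (Dc nN nB nC Lx Ly gamma - Ec nN nB nC Lx Ly * gamma) * be r.+1
    <= gamma * al r + Ec nN nB nC Lx Ly * gamma * be r.
  have h := window_descent exec async B0 X_ne X_cp (ltW Lx0) (ltW Ly0)
    grad_f_lip hLg dff dfg X_cv g0 (r * B).
  have eE : (Lx + nN * nC ^+ 2 * Ly) * nN * nB / 2 = Ec nN nB nC Lx Ly.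
    by rewrite /Ec; field.
  have eD : gamma * (gamma^-1 - (Lx + nC ^+ 2 * Ly) / 2 - (Lx + nN * nC ^+ 2 * Ly) * nB / 2)
      = Dc nN nB nC Lx Ly gamma.
    by rewrite /Dc; field; rewrite gt_eqF.
  rewrite -/nN -/nB -/nC eE -beE in h.
  have := ler_wpM2l (ltW g0) h; rewrite mulrDr mulrA mulrBr eD.
  rewrite /al /alpha_err succB -/xstar /ytrue -[wsum2 _ _ _]/(be r); lra.
have gap_al r : gamma ^+ 2 * al r.+1
    <= Fc nN nB m nC L Lx Ly lam * (2 / 5 * be r.+1 + 1 / 5 * be r).
  rewrite /al /alpha_err succB beE.
  by apply: (gap_window exec async B0 X_ne X_cp (ltW Lx0) (ltW Ly0)
    grad_f_lip hLg X_cv g0 (r * B) N0 Xxs Jcvx (ltW lam0) (fun u Xu => eb u gamma Xu g0)).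
have gc : 0 <= gamma * cc nN nB m nC L Lx Ly lam gamma <= 1 / 50 by rewrite ltW.
have rate := lyapunov_rate g0 D0 E0 (ltW c0) cF gE gc b0 hb al_ge0 be_ge0 al0 be0
  descent_al gap_al.
rewrite -/(rhoc nN nB m nC L Lx Ly lam gamma) -/rho0 -/a -/b in rate.
have rho_half : 1 / 2 <= rho0 by rewrite /rho0 /rhoc; lra.
have rho_gt0 : 0 < rho0 by lra.
have rho_lt1 : rho0 < 1 by rewrite /rho0 /rhoc; lra.
case: r0 r00 => // r _; rewrite subn1 /=; have [alr ber] := rate r.
split => //; first by rewrite rho_gt0.
  apply: le_trans (_ : a * rho0 ^+ r.+1 <= _); first by have [] := rate r.+1.
  have a0 : 0 <= a by apply: le_trans al0.
  by rewrite exprSr ler_wpM2l // ler_piMr ?exprn_ge0 ?ltW.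
have be_prev : be r <= 2 * (b * rho0 ^+ r).
  case: (r) => [|r']; first by rewrite be0 mulr_ge0 // mulr_ge0 // exprn_ge0 // ltW.
  apply: le_trans (rate r').2 _; rewrite exprSr [b * (_ * _)]mulrA.
  have q0 : 0 <= b * rho0 ^+ r' by rewrite mulr_ge0 // exprn_ge0 // ltW.
  by have := ler_wpM2l q0 rho_half; lra.
have h := output_energy exec async (r * B).
rewrite -beE -[wsum2 _ (_ - _) _]/(be r) -succB in h.
apply: le_trans h _; rewrite /d /dc -/b.
have w0 : 0 <= m * nC ^+ 2 by rewrite mulr_ge0 ?sqr_ge0.
have z0 : 0 <= b * rho0 ^+ r by rewrite mulr_ge0 // exprn_ge0 // ltW.
have -> : nB ^+ 2 * m * nC ^+ 2 * b * rho0 ^+ r = m * nC ^+ 2 * (nB ^+ 2 * (b * rho0 ^+ r)) by ring.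
rewrite -/m -/nC mulrAC [leLHS]mulrC; apply: ler_wpM2l => //.
have -> : B.-1%:R = nB - 1 by rewrite /nB -{2}(prednK B0) -natr1 addrK.
apply: (@le_trans _ _ ((nB - 1) * (3 * (b * rho0 ^+ r)))).
  by rewrite ler_wpM2l ?subr_ge0 //; lra.
rewrite mulrA ler_wpM2r //.
by have := sqr_ge0 (nB - 3 / 2); rewrite sqrrB; lra.
Qed.
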